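(* Let $n\ge2$ and let $X$ be the simply connected $n$-dimensional model space of constant curvature $c$, where $c=0$ ($X=\mathbb{R}^n$) or $c=1$ ($X=\mathbb{S}^n$). Then there is a constant $K>0$, independent of $f$, such that for every radial function $f:X\to\mathbb{C}$ in the Lorentz space $L^{n,1}(X)$, $$\left\|s_c'\left(d(o,\cdot)\right)R_1f(\cdot)\right\|_{L^\infty(\Xi_1(X))}\le K\|f\|_{L^{n,1}(X)}.$$
   Context: $\mathbb{R}^n$ and $\mathbb{S}^n$ (unit sphere) carry their standard Riemannian metrics of sectional curvature $c=0,1$, with Riemannian distance $d$ and Riemannian measure $\mu$. A point $o\in X$ is fixed as origin (realizing the spaces in $\mathbb{R}^{n+1}$ as $\{x_{n+1}=1\}$ and the unit sphere, $o=e_{n+1}$). $\delta(X)$ is the diameter of $X$: $\infty$ for $\mathbb{R}^n$ and $\pi$ for $\mathbb{S}^n$. The function $s_c$ is $s_0(t)=t$, $s_1(t)=\sin t$; thus $s_c'$ is $1$, $\cos t$ respectively. $\Xi_1(X)$ is the collection of all complete $1$-dimensional totally-geodesic submanifolds of $X$ (lines of $\mathbb{R}^n$, great circles of $\mathbb{S}^n$), equipped with its natural isometry-invariant measure. For $\xi\in\Xi_1(X)$, $d(o,\xi)=\inf_{x\in\xi}d(o,x)$, and $R_1f(\xi)=\int_\xi f(x)\,\mathrm{d}_\xi x$, where $\mathrm{d}_\xi x$ is the arc-length measure on $\xi$. A (measurable) function $f:X\to\mathbb{C}$ is radial if there is a function $\tilde f:s_c\left([0,\delta(X)/4)\right)\to\mathbb{C}$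 such that $f(x)=\tilde f\left(s_c\left(d(o,x)/2\right)\right)$. On the sphere only even functions ($f(-x)=f(x)$) are considered, and this identity is required for $d(o,x)<\pi/2$. $L^{n,1}(X)$ is the Lorentz space with (quasi-)norm $\|f\|_{L^{n,1}(X)}=\frac1n\int_0^\infty t^{1/n}f^*(t)\frac{\mathrm{d}t}{t}$, $f^*$ being the decreasing rearrangement of $f$ with respect to $\mu$; in particular $\|\chi_E\|_{L^{n,1}(X)}=\mu(E)^{1/n}$. *)

(* Defs.v *)
From HB Require Import structures.
From mathcomp Require Import all_boot all_order all_algebra.
From mathcomp Require Import all_classical all_reals all_analysis.
From mathcomp Require Import measurable_realfun complex ring.

Set Implicit Arguments.
Unset Strict Implicit.
Unset Printing Implicit Defensive.

Import Order.TTheory GRing.Theory Num.Theory.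
Import numFieldNormedType.Exports.

Local Open Scope classical_set_scope.
Local Open Scope ring_scope.

Section row_measurable.
Context {d : measure_display} {T : measurableType d}.
Variable n : nat.

Definition row_coor (i : 'I_n) (x : 'rV[T]_n) : T := x ord0 i.

Let row_set0 : g_sigma_preimage row_coor set0.
Proof. exact: sigma_algebra0. Qed.

Let row_setC A : g_sigma_preimage row_coor A -> g_sigma_preimage row_coor (~` A).
Proof. exact: sigma_algebraC. Qed.

Let row_bigcup (F : (set _)^nat) : (forall i, g_sigma_preimage row_coor (F i)) ->
  g_sigma_preimage row_coor (\bigcup_i (F i)).
Proof. exact: sigma_algebra_bigcup. Qed.

(* Product sigma-algebra, as the library does for tuples; for T = R these are
   the Borel sets of R^n. *)
HB.instance Definition _ := @isMeasurable.Build (measure_tuple_display d)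
  'rV[T]_n (g_sigma_preimage row_coor) row_set0 row_setC row_bigcup.

End row_measurable.

Section row_measurable_fun.
Context {d : measure_display} {T : measurableType d}.

Lemma measurable_row_coor n (i : 'I_n) :
  measurable_fun [set: 'rV[T]_n] (row_coor i).
Proof.
move=> _ Y mY; rewrite setTI; apply: sub_sigma_algebra => /=.
rewrite -bigcup_seq/=; exists i => /=; first by rewrite mem_index_enum.
by exists Y => //; rewrite setTI.
Qed.

Lemma measurable_fun_row d' (T' : measurableType d') n (f : T' -> 'rV[T]_n) :
  (forall i, measurable_fun [set: T'] (row_coor i \o f)) ->
  measurable_fun [set: T'] f.
Proof.
move=> mf _ A mA; rewrite setTI.
suff : g_sigma_preimage (@row_coor _ T n) `<=` image_set_system setT f measurable.
  by move=> /(_ A mA); rewrite /image_set_system/= setTI.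
apply: smallest_sub.
  exact/sigma_algebra_image/sigma_algebra_measurable.
case: n f mf A mA => [|n] f mf A mA; first by rewrite big_ord0.
rewrite -bigcup_mkord_ord; apply: bigcup_sub => i Ii.
move=> B [C mC <-]; rewrite /image_set_system/= !setTI.
have := mf (inord i) measurableT C mC.
by rewrite setTI.
Qed.

End row_measurable_fun.

Section lebesgue_row.
Context {R : realType}.

Definition row_cons n (p : R * 'rV[R]_n) : 'rV[R]_n.+1 :=
  row_mx (const_mx p.1 : 'rV_1) p.2.

Definition row_uncons n (x : 'rV[R]_n.+1) : R * 'rV[R]_n :=
  (x ord0 ord0, \row_i x ord0 (lift ord0 i)).

Lemma row_cons0 n (p : R * 'rV[R]_n) : row_cons p ord0 ord0 = p.1.
Proof.
have -> : ord0 = lshift n (ord0 : 'I_1) :> 'I_(1 + n) by exact: val_inj.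
by apply: etrans (row_mxEl _ _ _ _) _; rewrite mxE.
Qed.

Lemma row_cons_lift n (p : R * 'rV[R]_n) i :
  row_cons p ord0 (lift ord0 i) = p.2 ord0 i.
Proof.
have -> : lift ord0 i = rshift 1 i :> 'I_(1 + n) by exact: val_inj.
exact: row_mxEr.
Qed.

Lemma row_consK n : cancel (@row_cons n) (@row_uncons n).
Proof.
move=> [t y]; rewrite /row_uncons row_cons0; congr pair.
by apply/rowP => i; rewrite mxE row_cons_lift.
Qed.

Lemma measurable_row_cons n :
  measurable_fun [set: R * 'rV[R]_n] (@row_cons n).
Proof.
apply: measurable_fun_row => i; case: (unliftP ord0 i) => [j|] ->{i}.
  rewrite (_ : _ \o _ = row_coor j \o snd).
    by apply: measurableT_comp => //; exact: measurable_row_coor.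
  by apply/funext => p; rewrite /row_coor/= row_cons_lift.
rewrite (_ : _ \o _ = fst)//.
by apply/funext => p; rewrite /row_coor/= row_cons0.
Qed.

Lemma measurable_row_uncons n : measurable_fun [set: 'rV[R]_n.+1] (@row_uncons n).
Proof.
apply: measurable_fun_pair; first exact: measurable_row_coor.
apply: measurable_fun_row => i.
rewrite (_ : _ \o _ = row_coor (lift ord0 i)); first exact: measurable_row_coor.
by apply/funext => x; rewrite /row_coor/= mxE.
Qed.

Section step.
Variables (n : nat) (m : {sigma_finite_measure set 'rV[R]_n -> \bar R}).

Definition lebesgue_row_step : set 'rV[R]_n.+1 -> \bar R :=
  pushforward (@lebesgue_measure R \x m)%E (@row_cons n).

HB.instance Definition _ := Measure.copy lebesgue_row_step
  (measure_function_pushforward__canonical__measure_function_Measure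
    (@lebesgue_measure R \x m)%E (@measurable_row_cons n)).

Let sigma_finite_step : sigma_finite setT lebesgue_row_step.
Proof.
have /sigma_finiteP[F [FT ndF Foo]] := sigma_finiteT (@lebesgue_measure R).
have /sigma_finiteP[G [GT ndG Goo]] := sigma_finiteT m.
exists (fun k => @row_uncons n @^-1` (F k `*` G k)).
  apply/esym; rewrite -subTset => x _; set p := row_uncons x.
  have [i _ Fi] : (\bigcup_k F k) p.1 by rewrite -FT.
  have [j _ Gj] : (\bigcup_k G k) p.2 by rewrite -GT.
  exists (maxn i j) => //; split.
    by move: (p.1) Fi; exact/subsetPset/ndF/leq_maxl.
  by move: (p.2) Gj; exact/subsetPset/ndG/leq_maxr.
move=> k; have [mFk Fk] := Foo k; have [mGk Gk] := Goo k; split.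
  rewrite -[X in measurable X]setTI; apply: measurable_row_uncons => //.
  exact: measurableX.
rewrite /lebesgue_row_step /pushforward -comp_preimage.
rewrite (_ : _ \o _ = id) ?preimage_id; last first.
  by apply/funext => x /=; rewrite row_consK.
by rewrite product_measure1E// lte_mul_pinfty// ge0_fin_numE.
Qed.

HB.instance Definition _ := Measure_isSigmaFinite.Build _ _ _ lebesgue_row_step
  sigma_finite_step.

End step.

(* n-dimensional Lebesgue measure, as an n-fold product measure. *)
Fixpoint lebesgue_row (n : nat) : {sigma_finite_measure set 'rV[R]_n -> \bar R} :=
  match n with
  | 0%N => \d_ (0 : 'rV[R]_0)
  | m.+1 => lebesgue_row_step (lebesgue_row m)
  end.

End lebesgue_row.

Inductive model_space := Euclidean | Spherical.

Section model_geometry.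
Context {R : realType}.
Implicit Types (c : model_space) (n : nat).

Definition dot n (x y : 'rV[R]_n) : R := \sum_i x ord0 i * y ord0 i.

(* The library norm on 'rV[R]_n is the sup norm, hence this definition. *)
Definition enorm n (x : 'rV[R]_n) : R := Num.sqrt (dot x x).

Definition row_snoc n (u : 'rV[R]_n) (t : R) : 'rV[R]_n.+1 :=
  \row_i oapp (u ord0) t (unlift ord_max i).

Definition s_ c (t : R) : R :=
  match c with Euclidean => t | Spherical => sin t end.

Definition diameter c : \bar R :=
  match c with Euclidean => +oo%E | Spherical => pi%:E end.

(* X realized in R^(n+1): the hyperplane x_(n+1) = 1 or the unit sphere. *)
Definition model c n : set 'rV[R]_n.+1 :=
  match c with
  | Euclidean => [set x | x ord0 ord_max = 1]
  | Spherical => [set x | enorm x = 1]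
  end.

Definition origin n : 'rV[R]_n.+1 := delta_mx ord0 ord_max.

Definition rdist c n (x y : 'rV[R]_n.+1) : R :=
  match c with
  | Euclidean => enorm (x - y)
  | Spherical => acos (dot x y)
  end.

(* Riemannian measure in graph charts. The hyperplane is the graph of 1 over
   R^n, with density 1. The sphere is, up to the (null) equator, the union of
   the graphs of h and - h over the unit ball, h u = sqrt (1 - |u|^2); there
   g_ij = delta_ij + u_i u_j / h^2, so that sqrt (det g) = 1 / h. *)
Definition riemannian_measure c n (E : set 'rV[R]_n.+1) : \bar R :=
  match c with
  | Euclidean => lebesgue_row n [set u | E (row_snoc u 1)]
  | Spherical =>
      (\int[lebesgue_row n]_(u in [set u | (enorm u < 1)%R])
        (let h := Num.sqrt (1 - enorm u ^+ 2) in
         ((\1_E (row_snoc u h) + \1_E (row_snoc u (- h))) / h)%R)%:E)%E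
  end.

Definition unit_tangent c n (x v : 'rV[R]_n.+1) : Prop :=
  [/\ model c x, enorm v = 1 &
    match c with
    | Euclidean => v ord0 ord_max = 0
    | Spherical => dot x v = 0
    end].

(* x + t v in the Euclidean case, (cos t) x + (sin t) v in the spherical one. *)
Definition geodesic c n (p : 'rV[R]_n.+1 * 'rV[R]_n.+1) (t : R) : 'rV[R]_n.+1 :=
  derive1 (s_ c) t *: p.1 + s_ c t *: p.2.

Definition parametrizes c n (xi : set 'rV[R]_n.+1) : set ('rV[R]_n.+1 * 'rV[R]_n.+1) :=
  [set p | unit_tangent c p.1 p.2 /\ xi = range (geodesic c p)].

Definition Xi1 c n : set (set 'rV[R]_n.+1) :=
  [set xi | exists p, parametrizes c xi p].

(* A unit-speed geodesic is a bijection from this set onto its image. *)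
Definition arc_domain c : set R :=
  match c with Euclidean => setT | Spherical => `[0, 2 * pi[ end.

(* An arbitrary unit-speed parametrization of xi: two of them differ by a
   translation and a reflection of the parameter, so that integrals of f along
   xi with respect to arc length do not depend on the choice. *)
Definition along c n (xi : set 'rV[R]_n.+1) : R -> 'rV[R]_n.+1 :=
  geodesic c (get (parametrizes c xi)).

Definition integrable_along c n (xi : set 'rV[R]_n.+1) (f : 'rV[R]_n.+1 -> R[i]) :=
  lebesgue_measure.-integrable (arc_domain c) (fun t => (complex.Re (f (along c xi t)))%:E) /\
  lebesgue_measure.-integrable (arc_domain c) (fun t => (complex.Im (f (along c xi t)))%:E).

Definition R1_transform c n (f : 'rV[R]_n.+1 -> R[i]) (xi : set 'rV[R]_n.+1) : R[i] :=
  Complex (\int[lebesgue_measure]_(t in arc_domain c) complex.Re (f (along c xi t)))%R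
          (\int[lebesgue_measure]_(t in arc_domain c) complex.Im (f (along c xi t)))%R.

Definition dist_origin c n (xi : set 'rV[R]_n.+1) : R :=
  inf [set rdist c (origin n) x | x in xi].

End model_geometry.

Section geodesic_measure.
Context {R : realType}.
Implicit Types (c : model_space) (n : nat).

Definition pdim c n : nat :=
  match c with Euclidean => n | Spherical => n.+1 end.

(* Carrier of the invariant measure below, which is concentrated on Xi1 c n (see
   span_geodesicE); its sigma-algebra is the final one for span_geodesic. *)
Definition geodesic_space c n : Type := set 'rV[R]_n.+1.

HB.instance Definition _ c n := Pointed.on (geodesic_space c n).

(* The line through p.1 directed by p.2, resp. the great circle in the plane
   spanned by p.1 and p.2 (when p is in spanning_pairs c n). *)
Definition span_geodesic c n :
    'rV[R]_(pdim c n) * 'rV[R]_(pdim c n) -> geodesic_space c n :=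
  match c with
  | Euclidean => fun p => range (fun t => row_snoc (p.1 + t *: p.2) 1)
  | Spherical => fun p =>
      [set x | model Spherical x /\ exists a b, x = a *: p.1 + b *: p.2]
  end.

Definition spanning_pairs c n : set ('rV[R]_(pdim c n) * 'rV[R]_(pdim c n)) :=
  match c with
  | Euclidean => [set p | [/\ p.2 != 0, enorm p.2 <= 1 &
                              `|dot p.1 p.2| <= enorm p.2 / 2]]
  | Spherical => [set p | [/\ enorm p.1 <= 1, enorm p.2 <= 1 &
                              dot p.1 p.2 ^+ 2 != dot p.1 p.1 * dot p.2 p.2]]
  end.

Lemma measurable_dot d (T : measurableType d) n (f g : T -> 'rV[R]_n) :
  measurable_fun setT f -> measurable_fun setT g ->
  measurable_fun setT (fun x => dot (f x) (g x)).
Proof.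
move=> mf mg; apply: measurable_sum => i; apply: measurable_funM.
  by apply: (measurableT_comp (measurable_row_coor i)).
by apply: (measurableT_comp (measurable_row_coor i)).
Qed.

Lemma measurable_enorm d (T : measurableType d) n (f : T -> 'rV[R]_n) :
  measurable_fun setT f -> measurable_fun setT (fun x => enorm (f x)).
Proof.
move=> mf; apply: (measurableT_comp (f := @Num.sqrt R)).
  by apply: continuous_measurable_fun; exact: sqrt_continuous.
exact: measurable_dot.
Qed.

Lemma dot_eq0 n (x : 'rV[R]_n) : (dot x x == 0) = (x == 0).
Proof.
apply/eqP/eqP => [x0|->]; last by rewrite /dot big1// => i _; rewrite mxE mul0r.
have x2 (i : 'I_n) : true -> 0 <= x ord0 i * x ord0 i by rewrite -expr2 sqr_ge0.
apply/rowP => i; rewrite mxE; apply/eqP.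
move/eqP: x0; rewrite psumr_eq0// => /allP/(_ i (mem_index_enum _))/=.
by rewrite mulf_eq0 orbb.
Qed.

Lemma measurable_spanning_pairs c n : measurable (@spanning_pairs c n).
Proof.
have mset d (T : measurableType d) (f : T -> R) (A : set R) :
  measurable_fun setT f -> measurable A -> measurable (f @^-1` A).
  by move=> mf mA; rewrite -[X in measurable X]setTI; exact: mf.
have md d (T : measurableType d) m (f g : T -> 'rV[R]_m) :=
  @measurable_dot d T m f g.
have me d (T : measurableType d) m (f : T -> 'rV[R]_m) :=
  @measurable_enorm d T m f.
case: c => /=.
- rewrite (_ : [set p | _] =
    (fun p : 'rV[R]_n * 'rV[R]_n => dot p.2 p.2) @^-1` (~` [set 0]) `&`
    (fun p : 'rV[R]_n * 'rV[R]_n => enorm p.2) @^-1` `]-oo, 1] `&`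
    (fun p : 'rV[R]_n * 'rV[R]_n => enorm p.2 / 2 - `|dot p.1 p.2|) @^-1` `[0, +oo[).
    apply: measurableI; first apply: measurableI.
    + by apply: mset; [exact: md|exact: measurableC].
    + by apply: mset; [exact: me|].
    + apply: mset => //; apply: measurable_funB.
        by apply: measurable_funM => //; exact: me.
      by apply: measurableT_comp => //; exact: md.
  apply/seteqP; split=> p /=.
    move=> [p0 p1 p2]; rewrite !in_itv/= andbT subr_ge0; split; [split|] => //.
    by apply/eqP; rewrite dot_eq0.
  rewrite !in_itv/= andbT subr_ge0 => -[[/eqP p0 p1] p2]; split => //.
  by rewrite -dot_eq0.
- rewrite (_ : [set p | _] =
    (fun p : 'rV[R]_n.+1 * 'rV[R]_n.+1 => enorm p.1) @^-1` `]-oo, 1] `&`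
    (fun p : 'rV[R]_n.+1 * 'rV[R]_n.+1 => enorm p.2) @^-1` `]-oo, 1] `&`
    (fun p : 'rV[R]_n.+1 * 'rV[R]_n.+1 =>
       dot p.1 p.2 ^+ 2 - dot p.1 p.1 * dot p.2 p.2) @^-1` (~` [set 0])).
    apply: measurableI; first apply: measurableI.
    + by apply: mset; [exact: me|].
    + by apply: mset; [exact: me|].
    + apply: mset; last exact: measurableC.
      apply: measurable_funB; first by apply: measurable_funX; exact: md.
      by apply: measurable_funM; exact: md.
  apply/seteqP; split=> p /=; rewrite !in_itv/=.
    by move=> [p1 p2 p3]; split => //; apply/eqP; rewrite subr_eq0.
  by move=> [[p1 p2] /eqP]; rewrite subr_eq0.
Qed.

Lemma dotC n (x y : 'rV[R]_n) : dot x y = dot y x.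
Proof. by apply: eq_bigr => i _; rewrite mulrC. Qed.

Lemma dotDl n (x y z : 'rV[R]_n) : dot (x + y) z = dot x z + dot y z.
Proof. by rewrite -big_split; apply: eq_bigr => i _; rewrite mxE mulrDl. Qed.

Lemma dotZl n (a : R) (x y : 'rV[R]_n) : dot (a *: x) y = a * dot x y.
Proof. by rewrite /dot mulr_sumr; apply: eq_bigr => i _; rewrite mxE mulrA. Qed.

Lemma dotDr n (x y z : 'rV[R]_n) : dot x (y + z) = dot x y + dot x z.
Proof. by rewrite dotC dotDl !(dotC x). Qed.

Lemma dotZr n (a : R) (x y : 'rV[R]_n) : dot x (a *: y) = a * dot x y.
Proof. by rewrite dotC dotZl dotC. Qed.

Lemma dot_ge0 n (x : 'rV[R]_n) : 0 <= dot x x.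
Proof. by apply: sumr_ge0 => i _; rewrite -expr2 sqr_ge0. Qed.

Lemma sqr_enorm n (x : 'rV[R]_n) : enorm x ^+ 2 = dot x x.
Proof. by rewrite sqr_sqrtr// dot_ge0. Qed.

Lemma enorm_gt0 n (x : 'rV[R]_n) : (0 < enorm x) = (x != 0).
Proof. by rewrite sqrtr_gt0 lt_neqAle dot_ge0 andbT eq_sym dot_eq0. Qed.

Lemma enorm_eq1 n (x : 'rV[R]_n) : enorm x = 1 <-> dot x x = 1.
Proof.
split=> [x1|x1]; first by rewrite -sqr_enorm x1 expr1n.
by rewrite /enorm x1 sqrtr1.
Qed.

Lemma row_snoc_max n (u : 'rV[R]_n) t : row_snoc u t ord0 ord_max = t.
Proof. by rewrite mxE unlift_none. Qed.

Lemma row_snoc_lift n (u : 'rV[R]_n) t i :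
  row_snoc u t ord0 (lift ord_max i) = u ord0 i.
Proof. by rewrite mxE liftK. Qed.

Lemma row_snocD n (u v : 'rV[R]_n) s t :
  row_snoc (u + v) (s + t) = row_snoc u s + row_snoc v t.
Proof.
apply/rowP => i; case: (unliftP ord_max i) => [j|] ->.
  by rewrite [RHS]mxE !row_snoc_lift mxE.
by rewrite [RHS]mxE !row_snoc_max.
Qed.

Lemma row_snocZ n a (u : 'rV[R]_n) t : row_snoc (a *: u) (a * t) = a *: row_snoc u t.
Proof.
apply/rowP => i; case: (unliftP ord_max i) => [j|] ->.
  by rewrite [RHS]mxE !row_snoc_lift mxE.
by rewrite [RHS]mxE !row_snoc_max.
Qed.

Lemma dot_row_snoc n (u v : 'rV[R]_n) s t :
  dot (row_snoc u s) (row_snoc v t) = dot u v + s * t.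
Proof.
rewrite /dot big_ord_recr/= !row_snoc_max; congr (_ + _).
apply: eq_bigr => i _.
have -> : widen_ord (leqnSn n) i = lift ord_max i.
  by apply: val_inj; rewrite /= /bump leqNgt ltn_ord.
by rewrite !row_snoc_lift.
Qed.

Lemma row_snoc_ex n (x : 'rV[R]_n.+1) : exists u, x = row_snoc u (x ord0 ord_max).
Proof.
exists (\row_i x ord0 (lift ord_max i)).
apply/rowP => i; case: (unliftP ord_max i) => [j|] ->.
  by rewrite row_snoc_lift mxE.
by rewrite row_snoc_max.
Qed.

Lemma geodesicE c n (x v : 'rV[R]_n.+1) t : geodesic c (x, v) t =
  match c with
  | Euclidean => x + t *: v
  | Spherical => cos t *: x + sin t *: v
  end.
Proof.
case: c; rewrite /geodesic/=.
  by rewrite (_ : s_ Euclidean = id)// derive1_id scale1r.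
rewrite (_ : s_ Spherical = @sin R)// derive1E.
by have := is_derive_sin t => /(@derive_val _ _ _ _ _ _ _) ->.
Qed.

Lemma circle_angle (a b : R) : a ^+ 2 + b ^+ 2 = 1 ->
  exists t, a = cos t /\ b = sin t.
Proof.
move=> ab1.
have a1 : -1 <= a <= 1.
  by rewrite -ler_norml -(expr_le1 (n := 2))// real_normK ?num_real// -ab1 lerDl sqr_ge0.
have sab : Num.sqrt (1 - a ^+ 2) = `|b| by rewrite -ab1 addrAC subrr add0r sqrtr_sqr.
have [b0|b0] := leP 0 b.
  exists (acos a); rewrite acosK ?in_itv//= sin_acos// sab.
  by rewrite ger0_norm.
exists (- acos a); rewrite cosN sinN acosK ?in_itv//= sin_acos// sab.
by rewrite ltr0_norm// opprK.
Qed.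

Lemma span_geodesicE c n :
  @span_geodesic c n @` @spanning_pairs c n = @Xi1 R c n.
Proof.
apply/seteqP; split=> [_ [p pin <-]|xi [[x v] [[/= mx v1 xv] xiE]]].
- case: c p pin => -[u v] /=.
  + move=> [v0 _ _]; have nv : 0 < enorm v by rewrite enorm_gt0.
    exists (row_snoc u 1, row_snoc ((enorm v)^-1 *: v) 0); split => /=.
      split => /=; rewrite ?row_snoc_max//.
      apply/enorm_eq1; rewrite dot_row_snoc mulr0 addr0 dotZl dotZr -sqr_enorm.
      by field; rewrite gt_eqF.
    have E t : row_snoc (u + t *: v) 1 = row_snoc u 1 + t *: row_snoc v 0.
      by rewrite -row_snocZ mulr0 -row_snocD addr0.
    have -> : row_snoc ((enorm v)^-1 *: v) 0 = (enorm v)^-1 *: row_snoc v 0.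
      by rewrite -row_snocZ mulr0.
    apply/seteqP; split=> _ [t _ <-].
      exists (t * enorm v) => //; rewrite geodesicE scalerA E.
      by rewrite mulfK// gt_eqF.
    by exists (t / enorm v) => //; rewrite geodesicE scalerA E.
  + move=> [_ _ uv].
    have u0 : u != 0.
      apply/eqP => u0; move: uv; rewrite u0.
      by rewrite -(scale0r 0) !dotZl !mul0r expr0n eqxx.
    have du : dot u u != 0 by rewrite dot_eq0.
    pose w := v - (dot u v / dot u u) *: u.
    have uw : dot u w = 0.
      by rewrite dotDr -scaleNr dotZr; field.
    have ww : dot w w != 0.
      have -> : dot w w = (dot u u * dot v v - dot u v ^+ 2) / dot u u.
        rewrite /w -scaleNr !(dotDl, dotDr, dotZl, dotZr) (dotC v u).
        by field.
      by rewrite mulf_neq0// ?invr_eq0// subr_eq0 eq_sym.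
    have nu : enorm u != 0 by rewrite gt_eqF// enorm_gt0.
    have nw : enorm w != 0 by rewrite gt_eqF// enorm_gt0 -dot_eq0.
    pose e := (enorm u)^-1 *: u; pose f := (enorm w)^-1 *: w.
    have ee : dot e e = 1 by rewrite dotZl dotZr -sqr_enorm; field.
    have ff : dot f f = 1 by rewrite dotZl dotZr -sqr_enorm; field.
    have ef : dot e f = 0 by rewrite dotZl dotZr uw !mulr0.
    have uE : u = enorm u *: e by rewrite scalerA mulfV// scale1r.
    have wE : w = enorm w *: f by rewrite scalerA mulfV// scale1r.
    have vE : v = w + (dot u v / dot u u) *: u by rewrite subrK.
    clearbody e f.
    exists (e, f); split; first by split=> //=; exact/enorm_eq1.
    apply/seteqP; split=> [x [/enorm_eq1 x1 [a [b xE]]]|_ [t _ <-]].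
      pose a' := (a + b * (dot u v / dot u u)) * enorm u.
      pose b' := b * enorm w.
      have {}xE : x = a' *: e + b' *: f.
        rewrite xE {1}vE scalerDr scalerA addrCA addrC -scalerDl.
        by rewrite /a' /b' -!scalerA -uE -wE.
      have [t [tc ts]] : exists t, a' = cos t /\ b' = sin t.
        apply: circle_angle; rewrite -x1 xE.
        by rewrite !(dotDl, dotDr, dotZl, dotZr) ee ff (dotC f e) ef; ring.
      by exists t => //; rewrite geodesicE xE tc ts.
    rewrite geodesicE; split.
      apply/enorm_eq1; rewrite !(dotDl, dotDr, dotZl, dotZr) ee ff (dotC f e) ef.
      by rewrite !mulr0 !mulr1 add0r addr0 -!expr2 cos2Dsin2.
    exists (cos t / enorm u - sin t / enorm w * (dot u v / dot u u)).
    exists (sin t / enorm w).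
    have eE : e = (enorm u)^-1 *: u by rewrite {2}uE scalerA mulVf// scale1r.
    have fE : f = (enorm w)^-1 *: (v - (dot u v / dot u u) *: u).
      by rewrite -/w {2}wE scalerA mulVf// scale1r.
    rewrite eE fE scalerBr scalerBr !scalerA scalerBl addrA addrAC.
    by rewrite mulrA.
- case: c xi mx xv xiE => /= xi mx xv ->.
  + have [u uE] := row_snoc_ex x; have [w wE] := row_snoc_ex v.
    rewrite mx in uE; rewrite xv in wE.
    have ww : dot w w = 1.
      by move/enorm_eq1: v1; rewrite wE dot_row_snoc mulr0 addr0.
    have w1 : enorm w = 1 by exact/enorm_eq1.
    exists (u - dot u w *: w, w).
      split=> /=; first by rewrite -dot_eq0 ww oner_eq0.
        by rewrite w1.
      by rewrite -scaleNr dotDl dotZl ww mulr1 subrr normr0 w1 divr_ge0.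
    apply/seteqP; split=> _ [t _ <-] /=.
      exists (t - dot u w) => //; rewrite geodesicE uE wE.
      rewrite -row_snocZ mulr0 -row_snocD addr0; congr row_snoc.
      by rewrite -scaleNr -addrA -scalerDl (addrC t).
    exists (t + dot u w) => //; rewrite geodesicE uE wE.
    rewrite -row_snocZ mulr0 -row_snocD addr0; congr row_snoc.
    by rewrite -scaleNr -addrA -scalerDl [- _ + _]addrC addrK.
  + have xx : dot x x = 1 by exact/enorm_eq1.
    have vv : dot v v = 1 by exact/enorm_eq1.
    exists (x, v).
      by split=> /=; rewrite ?mx ?v1// xv xx vv mulr1 expr0n eq_sym oner_eq0.
    apply/seteqP; split=> [y [/enorm_eq1 y1 [a [b yE]]]|_ [t _ <-]] /=.
      have [t [tc ts]] : exists t, a = cos t /\ b = sin t.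
        apply: circle_angle; rewrite -y1 yE.
        by rewrite !(dotDl, dotDr, dotZl, dotZr) xx vv (dotC v x) xv; ring.
      by exists t => //; rewrite geodesicE yE tc ts.
    rewrite geodesicE; split; last by exists (cos t), (sin t).
    apply/enorm_eq1; rewrite !(dotDl, dotDr, dotZl, dotZr) xx vv (dotC v x) xv.
    by rewrite !mulr0 !mulr1 add0r addr0 -!expr2 cos2Dsin2.
Qed.

Definition geodesic_display : model_space -> nat -> measure_display.
Proof. by move=> _ _; exact: default_measure_display. Qed.

Section geodesic_measurable.
Variables (c : model_space) (n : nat).

Definition geodesic_algebra : set (set (geodesic_space c n)) :=
  image_set_system setT (@span_geodesic c n) measurable.

Let sigma_algebra_geodesic : sigma_algebra setT geodesic_algebra.
Proof. exact/sigma_algebra_image/sigma_algebra_measurable. Qed.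

Let geodesic_algebra0 : geodesic_algebra set0.
Proof. by have [] := sigma_algebra_geodesic. Qed.

Let geodesic_algebraC A : geodesic_algebra A -> geodesic_algebra (~` A).
Proof. by have [_ /(_ A)] := sigma_algebra_geodesic; rewrite setTD. Qed.

Let geodesic_algebraU (F : (set _)^nat) : (forall i, geodesic_algebra (F i)) ->
  geodesic_algebra (\bigcup_i F i).
Proof. by have [_ _] := sigma_algebra_geodesic; exact. Qed.

HB.instance Definition _ := @isMeasurable.Build (geodesic_display c n)
  (geodesic_space c n) geodesic_algebra
  geodesic_algebra0 geodesic_algebraC geodesic_algebraU.

Lemma measurable_span_geodesic : measurable_fun setT (@span_geodesic c n).
Proof. by move=> _ A. Qed.

(* The invariant measure on Xi1 c n, up to a constant factor. In the spherical
   case, Lebesgue measure on pairs of vectors of the unit ball of R^(n+1) is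
   invariant under O(n+1), hence so is its image on great circles. In the
   Euclidean case, for a fixed p.2, the points p.1 range over a slab of width 1
   around the hyperplane orthogonal to p.2; as the line only depends on the
   projection of p.1 to this hyperplane, and by polar coordinates for p.2, this is
     1/n * \int_(theta in S^(n-1)) \int_(x orthogonal to theta)
       (\1_A (x + R theta)) dx dtheta. *)
Definition geodesic_measure : set (geodesic_space c n) -> \bar R :=
  pushforward
    (mrestr (@lebesgue_row R (pdim c n) \x @lebesgue_row R (pdim c n))%E
      (@measurable_spanning_pairs c n))
    (@span_geodesic c n).

HB.instance Definition _ := Measure.copy geodesic_measure
  (measure_function_pushforward__canonical__measure_function_Measure
    (mrestr (@lebesgue_row R (pdim c n) \x @lebesgue_row R (pdim c n))%E
      (@measurable_spanning_pairs c n))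
    measurable_span_geodesic).

End geodesic_measurable.
End geodesic_measure.
Arguments geodesic_measure R c n _ : clear implicits.

Section function_spaces.
Context {R : realType}.
Implicit Types (c : model_space) (n : nat).

Definition measurable_on c n (f : 'rV[R]_n.+1 -> R[i]) : Prop :=
  measurable_fun (@model R c n) (fun x => complex.Re (f x)) /\
  measurable_fun (@model R c n) (fun x => complex.Im (f x)).

Definition sphere_even c n (f : 'rV[R]_n.+1 -> R[i]) : Prop :=
  c = Spherical -> forall x, model c x -> f (- x) = f x.

(* d(o,x) < diam X / 2 always holds in the Euclidean case. *)
Definition radial c n (f : 'rV[R]_n.+1 -> R[i]) : Prop :=
  exists ft : R -> R[i], forall x, model c x ->
    ((rdist c (origin n) x)%:E < diameter c * (2^-1)%:E)%E ->
    f x = ft (s_ c (rdist c (origin n) x / 2)).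

Definition rearrangement c n (f : 'rV[R]_n.+1 -> R[i]) (t : R) : \bar R :=
  ereal_inf [set s%:E | s in [set s : R | 0 <= s /\
    (riemannian_measure c [set x | model c x /\ (s < ComplexField.Normc.normc (f x))%R] <= t%:E)%E]].

Definition lorentz_norm c n (f : 'rV[R]_n.+1 -> R[i]) : \bar R :=
  ((n%:R^-1)%:E * \int[lebesgue_measure]_(t in `]0%R, +oo[)
    ((t `^ n%:R^-1)%:E * rearrangement c f t * (t^-1)%:E))%E.

Definition lorentz_space c n (f : 'rV[R]_n.+1 -> R[i]) : Prop :=
  measurable_on c f /\ (lorentz_norm c f < +oo)%E.

End function_spaces.

(* Main.v *)
(* Write |u| for the distance of the projection of x = (u, s) to R^n from 0: off
   the equator it determines |f x| for f radial (and even), so that the level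
   sets of |f| are the sets { |u| \in A }.  Let rho = s_c'(d(o, xi)).  On a line,
   |u|^2 = r^2 + (t - t0)^2; on a great circle, |u|^2 = 1 - rho^2 cos^2 (t - t0).
   For a > 0, the points at parameter distance < a from the points of xi nearest
   to o have length O(a).  On the other ones, |u| grows fast enough for
   rho |{t : p < |u| <= q}| to be at most C a^(1-n) mu {p < |u| <= q} for all
   p < q, hence rho |{t : |u| \in A}| <= C a^(1-n) mu {|u| \in A} for all Borel A.
   Optimizing in a yields rho |xi \cap E| <= C mu(E)^(1/n) for the level sets E of
   |f|, i.e. the restricted estimate, which is integrated over the levels by the
   layer cake formula. *)

From HB Require Import structures.
Require Import Defs.
From mathcomp Require Import all_boot all_order all_algebra.
From mathcomp Require Import all_classical all_reals all_analysis.
From mathcomp Require Import measurable_realfun ess_sup_inf complex ring lra.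

Import Order.TTheory GRing.Theory Num.Theory.
Import numFieldNormedType.Exports.

Local Open Scope classical_set_scope.
Local Open Scope ring_scope.
Local Open Scope complex_scope.

Set Implicit Arguments.
Unset Strict Implicit.

(** * Comparison of measures on intervals *)

(** The passage from intervals to Borel sets stands in for a change of variables: the images under
    |u| of arc length and of mu are compared as measures, and what is estimated along a geodesic is
    only the diameter of the part of a branch where p < |u| <= q. The shell p < |u| <= q has measure
    at least a constant times (q^n - p^n) times the density at p, and q^n - p^n >= q^(n-2) (q^2 -
    p^2). Away from the nearest points q is at least of order a, which yields n - 2 powers of a; the
    last one comes from the growth of q^2 - p^2 in the parameter. On a great circle |u| is
    stationary at the equator, but the density 2 / h blows up there at the compensating rate; what
    remains is the degeneracy of circles close to the equator, measured by rho. In the estimates the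
    dimension is written n + 2, so that the exponents are n and n + 1.

    [radial] says nothing about f on the equator. Great circles inside it form a null set of
    geodesics; any other one meets it for a null set of parameters, and the bound holds for each of
    these geodesics, not just almost all. *)

Section interval_domination.
Context {R : realType}.
Variables m1 m2 : {measure set (measurableTypeR R) -> \bar R}.

(** The same set function on another carrier: [ocitv_type R] carries the semiring of half-open
    intervals, from which the Caratheodory extension is built. *)
Definition ocitv_restr (A : set (ocitv_type R)) : \bar R := m2 A.

Let ocitv_restr0 : ocitv_restr set0 = 0%E.
Proof. exact: measure0. Qed.

Let ocitv_restr_ge0 A : (0 <= ocitv_restr A)%E.
Proof. exact: measure_ge0. Qed.

Let ocitv_restr_sigma_additive : semi_sigma_additive ocitv_restr.
Proof.
move=> F mF tF mUF; apply: measure_semi_sigma_additive => //.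
- by move=> i; apply: sub_sigma_algebra; exact: mF.
- exact: sub_sigma_algebra.
Qed.

HB.instance Definition _ := isMeasure.Build _ _ _ ocitv_restr
  ocitv_restr0 ocitv_restr_ge0 ocitv_restr_sigma_additive.

(** Every cover of [A] by half-open intervals has [m2]-mass at least its [m1]-mass, hence at least
    [m1 A], and [m2 A] is the infimum over such covers. Finiteness of [m2] gives the
    sigma-finiteness behind the uniqueness of the extension. *)
Lemma le_measure_ocitv : (m2 setT < +oo)%E ->
  (forall p q : R, p < q -> (m1 `]p, q]%classic <= m2 `]p, q]%classic)%E) ->
  forall A, measurable A -> (m1 A <= m2 A)%E.
Proof.
move=> m2fin m12 A mA.
have mo X : ocitv X -> @measurable _ (measurableTypeR R) X.
  by move=> ?; exact: sub_sigma_algebra.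
have m12o X : ocitv X -> (m1 X <= m2 X)%E.
  move=> /ocitvP[->|[x x12 ->]]; first by rewrite !measure0.
  exact: m12.
have sf : sigma_finite [set: ocitv_type R] ocitv_restr.
  have [F TF mF] := @wlength_sigma_finite R idfun.
  exists F => // k; have [mFk _] := mF k; split=> //.
  apply: le_lt_trans m2fin.
  apply: (@le_measure _ _ _ m2); rewrite ?inE//; exact: (mo _ mFk).
(* [m2] is the outer measure generated by its restriction to intervals. *)
rewrite -(@measure_extension_unique _ _ _ ocitv_restr sf m2)//.
apply: le_ereal_inf_tmp => _ [F [mF AF] <-].
apply: (@le_trans _ _ (\sum_(k <oo) m1 (F k))%E).
  by apply: measure_sigma_subadditive => // i; apply: mo; exact: mF.
apply: lee_nneseries => // i _; exact: m12o (mF i).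
Qed.

End interval_domination.

Section image_measure.
Context d d' (T1 : measurableType d) (T2 : measurableType d') (R : realType).

Lemma measurable_preimageT (f : T1 -> T2) (A : set T2) :
  measurable_fun setT f -> measurable A -> measurable (f @^-1` A).
Proof. by move=> mf mA; rewrite -[X in measurable X]setTI; exact: mf. Qed.

Definition image_measure (m : {measure set T1 -> \bar R}) (f : T1 -> T2)
    (mf : measurable_fun setT f) : {measure set T2 -> \bar R} :=
  measure_function_pushforward__canonical__measure_function_Measure m mf.

End image_measure.

(** * Volume of Euclidean balls *)

Section ball_volume.
Context {R : realType}.

Lemma lebesgue_measure_oc (a b : R) : a <= b ->
  @lebesgue_measure R `]a, b]%classic = (b - a)%:E.
Proof.
move=> ab; have := @lebesgue_measure_itv R `]a, b] => ->.
by rewrite /= lte_fin lt_neqAle ab andbT; case: eqVneq => //= ->; rewrite subrr.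
Qed.

(** By uniqueness of Lebesgue measure: r^-1 times the image under division by r gives ]a, b] the
    length of ]r a, r b] divided by r. *)
Lemma lebesgue_measure_scale (r : R) (A : set R) : 0 < r -> measurable A ->
  lebesgue_measure ((fun x => r^-1 * x) @^-1` A) = (r%:E * lebesgue_measure A)%E.
Proof.
move=> r0 mA.
have mr : measurable_fun [set: measurableTypeR R]
    (fun x : measurableTypeR R => r^-1 * x : measurableTypeR R).
  exact: (@mulrl_measurable R setT r^-1).
have ri0 : 0 <= r^-1 by rewrite invr_ge0 ltW.
pose m : {measure set (measurableTypeR R) -> \bar R} :=
  mscale (NngNum ri0) (image_measure (@lebesgue_measure R) mr).
have mE X : m X = ((r^-1)%:E * lebesgue_measure ((fun x => (r^-1 * x)%R) @^-1` X))%E by [].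
rewrite [in RHS](@lebesgue_measure_unique R m)//.
  by rewrite mE muleA -EFinM divff ?gt_eqF// mul1e.
move=> X /ocitvP[->|[[a b]/= ab ->]]; first by rewrite !measure0.
rewrite mE.
have -> : (fun x : measurableTypeR R => r^-1 * x) @^-1` `]a, b]%classic =
    `]r * a, r * b]%classic.
  apply/seteqP; split => x /=; rewrite !in_itv/=;
    by rewrite (mulrC r^-1) ltr_pdivlMr// ler_pdivrMr// ![r * _]mulrC.
have rab : r * a <= r * b by rewrite ler_pM2l// ltW.
rewrite (lebesgue_measure_oc (ltW ab)) [X in (_ * X)%E](lebesgue_measure_oc rab) -EFinM.
by congr EFin; field; rewrite gt_eqF.
Qed.

Lemma measurable_scale_row n (a : R) :
  measurable_fun setT (fun u : 'rV[R]_n => a *: u).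
Proof.
apply: measurable_fun_row => i.
rewrite (_ : _ \o _ = (fun u => a * row_coor i u)); last first.
  by apply/funext => u; rewrite /row_coor /= mxE.
by apply: measurable_funM => //; exact: measurable_row_coor.
Qed.

(** Induction on the dimension by uniqueness of product measures: on rectangles the rescaled image
    measure factors into the first coordinate and the others. *)
Lemma lebesgue_row_scale n (r : R) (A : set 'rV[R]_n) : 0 < r -> measurable A ->
  lebesgue_row n ((fun u => r^-1 *: u) @^-1` A) =
  ((r ^+ n)%:E * lebesgue_row n A)%E.
Proof.
move=> r0; elim: n A => [|n ih] A mA.
  rewrite expr0 mul1e (_ : _ @^-1` A = A)//; apply/funext => u /=.
  by congr (A _); rewrite [u]thinmx0 scaler0.
pose S (p : measurableTypeR R * 'rV[R]_n) : measurableTypeR R * 'rV[R]_n :=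
  (r^-1 * p.1, r^-1 *: p.2).
have mS : measurable_fun setT S.
  apply: measurable_fun_pair => /=.
    by apply: measurable_funM.
  by apply: measurableT_comp => //; exact: measurable_scale_row.
have ri0 : 0 <= (r ^+ n.+1)^-1 by rewrite invr_ge0 exprn_ge0// ltW.
pose m : {measure set (measurableTypeR R * 'rV[R]_n) -> \bar R} :=
  mscale (NngNum ri0)
  (image_measure (@lebesgue_measure R \x lebesgue_row n)%E mS).
have mE X : m X = (((r ^+ n.+1)^-1)%:E *
    (@lebesgue_measure R \x lebesgue_row n) (S @^-1` X))%E by [].
have mcA : measurable (@row_cons R n @^-1` A).
  by apply: measurable_preimageT => //; exact: measurable_row_cons.
have E : ((@lebesgue_measure R \x lebesgue_row n)%E (@row_cons R n @^-1` A) =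
    m (@row_cons R n @^-1` A)).
  apply: product_measure_unique => // B C mB mC.
  rewrite mE.
  rewrite (_ : S @^-1` (B `*` C) = ((fun x => r^-1 * x) @^-1` B) `*`
     ((fun u => r^-1 *: u) @^-1` C)); last by apply/seteqP; split.
  rewrite product_measure1E//; last 2 first.
  - exact: (measurable_preimageT (@mulrl_measurable R setT r^-1)).
  - by apply: measurable_preimageT => //; exact: measurable_scale_row.
  rewrite [X in (_ * (X * _))%E](lebesgue_measure_scale r0 mB) [X in (_ * (_ * X))%E]ih//.
  rewrite [X in (_ * X)%E](_ : _ = (r ^+ n.+1)%:E *
    (lebesgue_measure B * lebesgue_row n C))%E; last by rewrite exprS EFinM muleACA.
  by rewrite muleA -EFinM mulVf ?mul1e// gt_eqF// exprn_gt0.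
have stepE B : lebesgue_row n.+1 B =
  (@lebesgue_measure R \x lebesgue_row n)%E (@row_cons R n @^-1` B) by [].
rewrite !stepE E mE muleA -EFinM divff ?gt_eqF ?exprn_gt0// mul1e.
congr (_ _); apply/seteqP; split => -[t u] /=;
  rewrite /S/= (_ : r^-1 *: row_cons (t, u) = row_cons (r^-1 * t, r^-1 *: u))//;
  apply/rowP => i; case: (unliftP ord0 i) => [j|] ->{i};
  by rewrite mxE ?row_cons_lift ?row_cons0/= ?mxE.
Qed.

(** It enters the constants only through its positivity and finiteness, both obtained by comparison
    with a cube. *)
Definition ball_volume n := lebesgue_row n [set u : 'rV[R]_n | enorm u <= 1].

Lemma measurable_enorm_row n : measurable_fun setT (@enorm R n).
Proof. exact: (@measurable_enorm R _ _ n id). Qed.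

Lemma measurable_enorm_preimage n (A : set R) : measurable A ->
  measurable (@enorm R n @^-1` A).
Proof. by move=> mA; apply: measurable_preimageT => //; exact: measurable_enorm_row. Qed.

Lemma measurable_ball n (r : R) : measurable [set u : 'rV[R]_n | enorm u <= r].
Proof. by have := @measurable_enorm_preimage n _ (measurable_itv `]-oo, r]). Qed.

Lemma enormZ n (a : R) (u : 'rV[R]_n) : enorm (a *: u) = `|a| * enorm u.
Proof.
by rewrite /enorm dotZl dotZr mulrA -expr2 sqrtrM ?sqr_ge0// sqrtr_sqr.
Qed.

Lemma lebesgue_ball n (r : R) : 0 < r ->
  lebesgue_row n [set u : 'rV[R]_n | enorm u <= r] = ((r ^+ n)%:E * ball_volume n)%E.
Proof.
move=> r0; rewrite /ball_volume -lebesgue_row_scale//; last exact: measurable_ball.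
congr (lebesgue_row n _); apply/seteqP; split => u /=; rewrite enormZ gtr0_norm ?invr_gt0//;
  by rewrite mulrC ler_pdivrMr// mul1r.
Qed.

Lemma measurable_cube n : measurable [set u : 'rV[R]_n | forall i, `|u ord0 i| <= 1].
Proof.
rewrite (_ : [set u | _] = \bigcap_(i in [set: 'I_n]) (row_coor i @^-1` [set x : R | `|x| <= 1])).
  apply: fin_bigcap_measurable => // i _; apply: measurable_preimageT.
    exact: measurable_row_coor.
  rewrite (_ : [set x | _] = `[-1, 1]%classic)//.
  by apply/seteqP; split => x; rewrite /= in_itv/= ler_norml.
by apply/seteqP; split => u /= h i; [move=> _; exact: h|exact: (h i I)].
Qed.

Lemma lebesgue_cube n :
  lebesgue_row n [set u : 'rV[R]_n | forall i, `|u ord0 i| <= 1] = (2 ^+ n)%:E.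
Proof.
elim: n => [|n ih].
  by rewrite /= diracE mem_set// => -[].
rewrite /= /lebesgue_row_step /pushforward.
rewrite (_ : _ @^-1` _ = `[-1, 1]%classic `*`
    [set u : 'rV[R]_n | forall i, `|u ord0 i| <= 1]).
  rewrite product_measure1E//; last exact: measurable_cube.
  rewrite [X in (_ * X)%E]ih [X in (X * _)%E](@lebesgue_measure_itv R `[-1, 1]).
  rewrite /= lte_fin ifT; last lra.
  by rewrite -EFinB -EFinM exprS; congr EFin; rewrite opprK.
apply/seteqP; split => -[t u] /=.
  move=> h; split; first by have := h ord0; rewrite row_cons0/= in_itv/= ler_norml.
  by move=> i; have := h (lift ord0 i); rewrite row_cons_lift.
rewrite in_itv/= -ler_norml => -[t1 u1] i.
by case: (unliftP ord0 i) => [j|] ->; rewrite ?row_cons_lift ?row_cons0.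
Qed.

Lemma coor_le_enorm n (u : 'rV[R]_n) i : `|u ord0 i| <= enorm u.
Proof.
rewrite -sqrtr_sqr ler_wsqrtr// /dot (bigD1 i)//= -expr2 lerDl.
by apply: sumr_ge0 => j _; rewrite -expr2 sqr_ge0.
Qed.

Lemma ball_volume_lty n : (ball_volume n < +oo)%E.
Proof.
apply: (@le_lt_trans _ _ (2 ^+ n)%:E); last by rewrite ltry.
rewrite -lebesgue_cube; apply: le_measure; rewrite ?inE.
- exact: measurable_ball.
- exact: measurable_cube.
- by move=> u /= u1 i; apply: le_trans u1; exact: coor_le_enorm.
Qed.

(** If the unit ball were null, so would be its dilates and hence their union R^n, against the
    volume 2^n of the cube. *)
Lemma ball_volume_gt0 n : (0 < ball_volume n)%E.
Proof.
rewrite lt0e measure_ge0 andbT; apply/negP => /eqP w0.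
have : lebesgue_row n [set u : 'rV[R]_n | forall i, `|u ord0 i| <= 1] = 0%E.
  apply: (@subset_measure0 _ _ _ _ _
    (\bigcup_k [set u : 'rV[R]_n | enorm u <= k.+1%:R])) => //.
  - exact: measurable_cube.
  - by apply: bigcupT_measurable => k; exact: measurable_ball.
  - move=> u _; exists (Num.bound (enorm u)) => //=.
    apply/ltW; apply: (@lt_trans _ _ (Num.bound (enorm u))%:R).
      by apply: archi_boundP; exact: sqrtr_ge0.
    by rewrite ltr_nat.
  have mb k : measurable [set u : 'rV[R]_n | enorm u <= k.+1%:R] by exact: measurable_ball.
  apply/eqP; rewrite eq_le measure_ge0 andbT.
  apply: le_trans (measure_sigma_subadditive _ mb _ _) _ => //.
    exact: bigcupT_measurable.
  by rewrite eseries0// => k _ _; rewrite [LHS]lebesgue_ball// w0 mule0.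
by rewrite lebesgue_cube => /eqP; rewrite eqe expf_eq0/= pnatr_eq0 andbF.
Qed.

End ball_volume.

(** * Distribution of the radius *)

Section radial_measure.
Context {R : realType}.
Implicit Types (c : model_space) (n : nat).

(* On the sphere 2 / h, with h the height: both hemispheres are graphs over the
   unit ball.  As sqrt (1 - r^2) = 0 for r >= 1, it vanishes outside the ball. *)
Definition radial_weight c (r : R) : R :=
  match c with Euclidean => 1 | Spherical => 2 / Num.sqrt (1 - r ^+ 2) end.

Lemma radial_weight_ge0 c r : 0 <= radial_weight c r.
Proof. by case: c => //=; rewrite divr_ge0// sqrtr_ge0. Qed.

Lemma measurable_radial_weight c : measurable_fun setT (radial_weight c).
Proof.
case: c => /=; first exact: measurable_cst.
rewrite (_ : radial_weight Spherical = (fun r : R => 2 * Num.sqrt (1 - r ^+ 2) `^ (- 1))).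
  apply: measurable_funM; first exact: measurable_cst.
  apply: (measurableT_comp (measurable_powR (-1))).
  apply: (measurableT_comp (f := @Num.sqrt R)).
    by apply: continuous_measurable_fun; exact: sqrt_continuous.
  by apply: measurable_funB => //; exact: measurable_funX.
by apply/funext => r; rewrite powR_inv1// sqrtr_ge0.
Qed.

Lemma measurable_radial_weight_enorm c n (D : set 'rV[R]_n) :
  measurable_fun D (fun u => (radial_weight c (enorm u))%:E).
Proof.
apply: measurable_funTS; apply/measurable_EFinP.
by apply: measurableT_comp; [exact: measurable_radial_weight|exact: measurable_enorm_row].
Qed.

(** The image of the Riemannian measure under (u, s) |-> |u|, see [riemannian_radial]. *)
Definition radial_measure c n (A : set (measurableTypeR R)) : \bar R :=
  (\int[lebesgue_row n]_(u in @enorm R n @^-1` A) (radial_weight c (enorm u))%:E)%E.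

Section measure.
Variables (c : model_space) (n : nat).

Let radial_measure0 : radial_measure c n set0 = 0%E.
Proof. by rewrite /radial_measure preimage_set0 integral_set0. Qed.

Let radial_measure_ge0 A : (0 <= radial_measure c n A)%E.
Proof. by apply: integral_ge0 => u _; rewrite lee_fin radial_weight_ge0. Qed.

Let radial_measure_sigma_additive : semi_sigma_additive (radial_measure c n).
Proof.
move=> F mF tF mUF; rewrite /radial_measure; apply: cvg_toP.
  apply: ereal_nondecreasing_is_cvgn => k m km.
  by apply: lee_sum_nneg_natr => // i _ _; exact: radial_measure_ge0.
rewrite preimage_bigcup ge0_integral_bigcup//=.
- by move=> k; exact: (@measurable_enorm_preimage _ n _ (mF k)).
- exact: measurable_radial_weight_enorm.
- by move=> u _; rewrite lee_fin radial_weight_ge0.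
- apply/trivIsetP => /= i j _ _ ij; rewrite -preimage_setI.
  by move/trivIsetP : tF => /(_ _ _ _ _ ij) ->//; rewrite preimage_set0.
Qed.

HB.instance Definition _ := isMeasure.Build _ _ _ (radial_measure c n)
  radial_measure0 radial_measure_ge0 radial_measure_sigma_additive.

End measure.

(* The range of |u|, for (u, s) a point of X off the equator. *)
Definition radius_lt c (r : R) : Prop :=
  match c with Euclidean => True | Spherical => r < 1 end.

Lemma ler_radial_weight c (p q : R) : 0 <= p <= q -> radius_lt c q ->
  radial_weight c p <= radial_weight c q.
Proof.
case: c => //= /andP[p0 pq] q1; have q0 := le_trans p0 pq.
have h0 (r : R) : 0 <= r -> r <= q -> 0 < 1 - r ^+ 2.
  by move=> r0 rq; rewrite subr_gt0 expr_lt1// (le_lt_trans rq).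
rewrite ler_pM2l// lef_pV2 ?posrE ?sqrtr_gt0 ?h0//.
by rewrite ler_wsqrtr// lerD2l lerN2 ler_pXn2r ?nnegrE.
Qed.

Lemma radial_measure_lty c n (q : R) : radius_lt c q ->
  (radial_measure c n `]-oo, q]%classic < +oo)%E.
Proof.
move=> qc; apply: (@le_lt_trans _ _
  (\int[lebesgue_row n]_(u in [set u : 'rV[R]_n | (enorm u <= `|q|)%R]) (radial_weight c q)%:E)%E).
  rewrite (_ : radial_measure _ _ _ = (\int[lebesgue_row n]_(u in
     [set u : 'rV[R]_n | (enorm u <= q)%R]) (radial_weight c (enorm u))%:E)%E).
    apply: (@le_trans _ _ (\int[lebesgue_row n]_(u in
     [set u : 'rV[R]_n | (enorm u <= q)%R]) (radial_weight c q)%:E)%E).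
      apply: ge0_le_integral => //.
      - exact: measurable_ball.
      - by move=> u _; rewrite lee_fin radial_weight_ge0.
      - exact: measurable_radial_weight_enorm.
      - move=> u /= uq; rewrite lee_fin ler_radial_weight// sqrtr_ge0//.
    apply: ge0_subset_integral => //.
    - exact: measurable_ball.
    - exact: measurable_ball.
    - by move=> u _; rewrite lee_fin radial_weight_ge0.
    - by move=> u /= uq; rewrite (le_trans uq)// ler_norm.
  by congr (integral _ _ _); apply/seteqP; split => u /=; rewrite in_itv.
rewrite integral_cst; last exact: measurable_ball.
(* The radius |q| + 1 is positive, as [lebesgue_ball] requires. *)
apply: (@le_lt_trans _ _ ((radial_weight c q)%:E * lebesgue_row n
    [set u : 'rV[R]_n | (enorm u <= `|q| + 1)%R])%E).
  apply: lee_wpmul2l; first by rewrite lee_fin radial_weight_ge0.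
  apply: le_measure; rewrite ?inE; [exact: measurable_ball..|].
  by move=> u /= uq; rewrite (le_trans uq)// lerDl.
rewrite lebesgue_ball ?ltr_wpDl// muleA -EFinM.
have w0 := @ball_volume_gt0 R n; have wy := @ball_volume_lty R n.
by rewrite lte_mul_pinfty// lee_fin mulr_ge0 ?radial_weight_ge0// exprn_ge0// addr_ge0.
Qed.

(** The new case is r = 0: the origin is null, since it lies in balls of radius d <= 1, for which
    d^n <= d. *)
Lemma lebesgue_ball_le n (r : R) : (0 < n)%N -> 0 <= r ->
  (lebesgue_row n [set u : 'rV[R]_n | (enorm u <= r)%R] <=
   (r ^+ n)%:E * ball_volume n)%E.
Proof.
move=> n0; rewrite le_eqVlt => /predU1P[<-|r0]; last by rewrite lebesgue_ball.
rewrite expr0n gtn_eqF// mul0e.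
have wy := @ball_volume_lty R n; have w0 := @ball_volume_gt0 R n.
have wf : @ball_volume R n \is a fin_num by rewrite ge0_fin_numE// ltW.
apply/lee_addgt0Pr => e e0; rewrite add0e.
pose w := fine (@ball_volume R n); have w0' : 0 < w by rewrite fine_gt0// w0.
pose d := Num.min 1 (e / w).
have d0 : 0 < d by rewrite lt_min ltr01 divr_gt0.
apply: (@le_trans _ _ (lebesgue_row n [set u : 'rV[R]_n | (enorm u <= d)%R])).
  apply: le_measure; rewrite ?inE; [exact: measurable_ball..|].
  by move=> u /= u0; rewrite (le_trans u0)// ltW.
rewrite lebesgue_ball// -(fineK wf) -EFinM lee_fin -ler_pdivlMr//.
apply: (@le_trans _ _ d); last by rewrite ge_min lexx orbT.
rewrite -(prednK n0) exprS ler_piMr ?(ltW d0)//.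
by rewrite exprn_ile1 ?(ltW d0)// ge_min lexx.
Qed.

(** The weight is nondecreasing, hence at least its value at [p] on the shell, whose volume is a
    difference of volumes of balls. This is the lower bound on mu that the estimates along geodesics
    rely on. *)
Lemma radial_measure_ge c n (p q : R) : (0 < n)%N -> 0 <= p <= q -> radius_lt c q ->
  ((radial_weight c p * (q ^+ n - p ^+ n))%:E * ball_volume n <=
   radial_measure c n `]p, q]%classic)%E.
Proof.
move=> n0 /andP[p0 pq] qc.
have wy := @ball_volume_lty R n; have w0 := @ball_volume_gt0 R n.
have wf : @ball_volume R n \is a fin_num by rewrite ge0_fin_numE// ltW.
pose S := [set u : 'rV[R]_n | enorm u <= q] `\` [set u : 'rV[R]_n | enorm u <= p].
have mS : measurable S by apply: measurableD; exact: measurable_ball.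
have SE : @enorm R n @^-1` `]p, q]%classic = S.
  apply/seteqP; split => u /=; rewrite in_itv/=.
    by move=> /andP[pu uq]; split => //; apply/negP; rewrite -ltNge.
  by move=> [-> /negP]; rewrite -ltNge => ->.
rewrite /radial_measure SE.
apply: (@le_trans _ _ (\int[lebesgue_row n]_(u in S) (radial_weight c p)%:E)%E).
  rewrite integral_cst// EFinM -muleA; apply: lee_wpmul2l.
    by rewrite lee_fin radial_weight_ge0.
  move: pq; rewrite le_eqVlt => /predU1P[->|pq]; first by rewrite subrr mul0e.
  have q0 : 0 < q by exact: le_lt_trans pq.
  have bq : lebesgue_row n [set u : 'rV[R]_n | enorm u <= q] =
    ((q ^+ n)%:E * ball_volume n)%E by exact: lebesgue_ball.
  have qfin : (lebesgue_row n [set u : 'rV[R]_n | (enorm u <= q)%R] < +oo)%E.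
    by rewrite bq lte_mul_pinfty// lee_fin exprn_ge0// ltW.
  rewrite /S measureD//; [|exact: measurable_ball..].
  rewrite setIidr; last by move=> u /= up; rewrite (le_trans up)// ltW.
  rewrite [X in (_ <= X - _)%E]bq EFinB muleBl//.
  by apply: leeB => //; exact: lebesgue_ball_le.
apply: ge0_le_integral => //.
- by move=> u _; rewrite lee_fin radial_weight_ge0.
- exact: measurable_radial_weight_enorm.
move=> u [/= uq /negP]; rewrite -ltNge => pu.
rewrite lee_fin ler_radial_weight ?p0 ?ltW//.
by case: c qc => //= q1; exact: le_lt_trans q1.
Qed.

(** On the sphere the two graph points over [u] have the same radius, so their indicators agree and
    add up to the 2 of [radial_weight]. [Q] is tested only off the equator, which the charts
    miss. *)
Lemma riemannian_radial c n (Q : 'rV[R]_n.+1 -> Prop) (B : set R) : measurable B ->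
  (forall u s, model c (row_snoc u s) -> radius_lt c (enorm u) ->
     Q (row_snoc u s) <-> B (enorm u)) ->
  riemannian_measure c [set x | model c x /\ Q x] = radial_measure c n B.
Proof.
move=> mB QB; have mEB := @measurable_enorm_preimage _ n _ mB.
case: c QB => QB /=.
  rewrite /radial_measure/= integral_cst// mul1e.
  congr (lebesgue_row n _); apply/seteqP; split => u /=.
    by move=> [mx Qx]; exact/(QB _ _ mx I).
  have mx : row_snoc u 1 ord0 ord_max = 1 :> R by rewrite row_snoc_max.
  by move=> Bu; split => //; exact/(QB _ _ mx I).
rewrite /radial_measure integral_mkcond [RHS]integral_mkcond.
apply: eq_integral => u _; rewrite !patchE.
have -> : (u \in [set u : 'rV[R]_n | enorm u < 1]) = (enorm u < 1).
  by apply/idP/idP; rewrite inE.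
have [u1|u1] := ltP; last first.
  case: ifP => // _; rewrite /radial_weight ler0_sqrtr ?invr0 ?mulr0//.
  by rewrite subr_le0 exprn_ege1.
have h0 : 0 < 1 - enorm u ^+ 2 by rewrite subr_gt0 expr_lt1// sqrtr_ge0.
have mh s : s ^+ 2 = 1 - enorm u ^+ 2 -> @model R Spherical n (row_snoc u s).
  by move=> s2; apply/enorm_eq1; rewrite dot_row_snoc -expr2 s2 -sqr_enorm addrC subrK.
have hh s : s ^+ 2 = 1 - enorm u ^+ 2 ->
    \1_([set x | model Spherical x /\ Q x]) (row_snoc u s) = \1_B (enorm u) :> R.
  move=> /mh ms; rewrite !indicE; congr (nat_of_bool _)%:R.
  apply/idP/idP; rewrite !inE/=; first by move=> [_]; move/(QB _ _ ms u1).
  by move=> Bu; split => //; exact/(QB _ _ ms u1).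
have hs : Num.sqrt (1 - enorm u ^+ 2) ^+ 2 = 1 - enorm u ^+ 2.
  by rewrite [LHS]sqr_sqrtr// ltW.
rewrite (hh _ hs) (hh (- _)) ?sqrrN//.
rewrite indicE (_ : (u \in @enorm R n @^-1` B) = (enorm u \in B)); last first.
  by apply/idP/idP; rewrite !inE.
by case: ifP => _ /=; rewrite ?addr0 ?mul0r.
Qed.

End radial_measure.

(** * Radial sets on a geodesic *)

Section branch.
Context {R : realType}.

Lemma lebesgue_measure_diam (B : set R) (d : R) : measurable B -> 0 <= d ->
  (forall x y, B x -> B y -> x <= y -> y - x <= d) ->
  (@lebesgue_measure R B <= d%:E)%E.
Proof.
move=> mB d0 Bd; have [->|/set0P[b Bb]] := eqVneq B set0; first by rewrite measure0.
have Bd' x y : B x -> B y -> y - x <= d.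
  move=> Bx By; have [xy|/ltW yx] := leP x y; first exact: Bd.
  by apply: le_trans d0; rewrite subr_le0.
have lB : has_lbound B.
  by exists (b - d) => x Bx; rewrite lerBlDr -lerBlDl; exact: Bd'.
pose a := inf B.
apply: (@le_trans _ _ (@lebesgue_measure R `[a, a + d]%classic)).
  apply: le_measure; rewrite ?inE//.
  move=> x Bx; rewrite /= in_itv/= ge_inf//= -lerBlDr.
  apply: lb_le_inf; first by exists b.
  by move=> y By; rewrite lerBlDr -lerBlDl; exact: Bd'.
rewrite (@lebesgue_measure_itv R `[a, a + d])/= lte_fin ltrDl.
by case: ifP => // _; rewrite -EFinD lee_fin addrAC subrr add0r.
Qed.

(* [m2] may be infinite near the equator, hence the truncation at [e]. *)
Lemma branch_truncated (m2 : {measure set (measurableTypeR R) -> \bar R})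
    (N : R -> R) (T : set R) (M e : R) :
  measurable_fun setT N -> measurable T -> 0 <= M ->
  (m2 `]-oo, e]%classic < +oo)%E ->
  (forall p q t t', p < q -> q <= e -> T t -> T t' -> p < N t <= q ->
    p < N t' <= q -> t <= t' -> ((t' - t)%:E <= M%:E * m2 `]p, q]%classic)%E) ->
  forall A, measurable A ->
    (@lebesgue_measure R (T `&` [set t | (N t <= e)%R /\ A (N t)]) <= M%:E * m2 A)%E.
Proof.
move=> mN mT M0 m2e H A mA.
have mle : measurable (N @^-1` `]-oo, e]%classic) by exact: measurable_preimageT.
have mS : @measurable _ (measurableTypeR R) (T `&` N @^-1` `]-oo, e]%classic).
  exact: (@measurableI _ R).
have mN' : measurable_fun setT (N : measurableTypeR R -> measurableTypeR R) by [].
have me : @measurable _ (measurableTypeR R) (`]-oo, e]%classic).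
  exact: (@measurable_itv R `]-oo, e]).
(* Both sides become measures in the variable N t: [m1] is the image of Lebesgue measure on the
   truncated branch, [m3] is M times the truncation of [m2], which is finite. *)
pose m1 : {measure set (measurableTypeR R) -> \bar R} :=
  image_measure (mrestr (@lebesgue_measure R) mS) mN'.
pose m3 : {measure set (measurableTypeR R) -> \bar R} :=
  mscale (NngNum M0) (mrestr m2 me).
have m1E B : m1 B = @lebesgue_measure R (N @^-1` B `&` (T `&` N @^-1` `]-oo, e]%classic)) by [].
have m3E B : m3 B = (M%:E * m2 (B `&` `]-oo, e]%classic))%E by [].
have m13 : forall B, measurable B -> (m1 B <= m3 B)%E.
  apply: le_measure_ocitv.
    by rewrite m3E setTI lte_mul_pinfty// ?ge0_fin_numE// lee_fin.
  move=> p q pq; rewrite m1E m3E.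
  have [qe|qe] := ltP p (Num.min q e); last first.
    rewrite (_ : _ `&` _ = set0) ?measure0 ?mule_ge0//.
    rewrite -subset0 => t /= [+ [_]]; rewrite !in_itv/= => /andP[pt tq] te.
    by move: (le_lt_trans qe pt); rewrite gt_min !ltNge tq te.
  have -> : `]p, q]%classic `&` `]-oo, e]%classic = `]p, Num.min q e]%classic.
    apply/seteqP; split => r /=; rewrite !in_itv/= le_min.
      by move=> [/andP[-> ->] ->].
    by move=> /and3P[-> -> ->].
  have m2fin : m2 `]p, Num.min q e]%classic \is a fin_num.
    rewrite ge0_fin_numE//; apply: le_lt_trans m2e; apply: le_measure; rewrite ?inE//.
    by move=> r /=; rewrite !in_itv/= le_min => /and3P[].
  (* No shape is known for the preimage of an interval; its diameter bounds its measure. *)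
  rewrite -(fineK m2fin) -EFinM; apply: lebesgue_measure_diam.
  - apply: (@measurableI _ R) => //; apply: measurable_preimageT => //.
  - by rewrite mulr_ge0// fine_ge0.
  move=> t t' [/= tpq [Tt te]] [/= tpq' [Tt' te']] tt'.
  rewrite -lee_fin EFinM fineK//; apply: H => //.
  - by rewrite ge_min lexx orbT.
  - by move: tpq te; rewrite !in_itv/= le_min => /andP[-> ->].
  - by move: tpq' te'; rewrite !in_itv/= le_min => /andP[-> ->].
apply: (@le_trans _ _ (m1 A)).
  rewrite m1E le_eqVlt; apply/orP; left; apply/eqP; congr (lebesgue_measure _).
  by apply/seteqP; split => t /=; rewrite in_itv/=; tauto.
apply: le_trans (m13 A mA) _; rewrite m3E lee_wpmul2l ?lee_fin//.
by apply: le_measure; rewrite ?inE//; exact: measurableI.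
Qed.

(** Truncation levels for [branch_truncated]: k on R^n, 1 - 1/(k+1) on the sphere. Below each of
    them the radial measure is finite. *)
Lemma radius_lt_exhaustion c : exists e : nat -> R,
  [/\ forall k, radius_lt c (e k), nondecreasing_seq e &
      forall r, radius_lt c r -> exists k, r <= e k].
Proof.
case: c => /=.
  exists (fun k => k%:R); split=> // [k m km|r _]; first by rewrite ler_nat.
  exists (Num.bound `|r|); apply: (le_trans (ler_norm r)).
  by apply/ltW/archi_boundP/normr_ge0.
exists (fun k => 1 - k.+1%:R^-1); split=> [k|k m km|r r1].
- by rewrite ltrBlDr ltrDl invr_gt0 ltr0n.
- by rewrite lerD2l lerN2 lef_pV2 ?posrE ?ltr0n// ler_nat.
exists (Num.bound (1 - r)^-1); rewrite lerBrDr addrC -lerBrDr.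
have r0 : 0 < 1 - r by rewrite subr_gt0.
rewrite -[leRHS]invrK lef_pV2 ?posrE ?invr_gt0// ?ltr0n//.
have b0 : 0 <= (1 - r)^-1 by rewrite invr_ge0 ltW.
apply: (le_trans (ltW (archi_boundP b0))).
by rewrite ler_nat.
Qed.

(** The truncated inequality holds at each level [e k], and k tends to infinity by monotone
    convergence. [radial_measure_ge] converts the hypothesis on p and q into that of
    [branch_truncated]. *)
Lemma radial_branch c n (N : R -> R) (T : set R) (M : R) :
  (0 < n)%N -> measurable_fun setT N -> measurable T -> 0 <= M ->
  (forall t, T t -> 0 < N t) ->
  (forall p q t t', 0 <= p -> p < q -> radius_lt c q -> T t -> T t' ->
    p < N t <= q -> p < N t' <= q -> t <= t' ->
    t' - t <= M * (radial_weight c p * (q ^+ n - p ^+ n))) ->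
  forall A, measurable A ->
    (@lebesgue_measure R (T `&` [set t | radius_lt c (N t) /\ A (N t)]) <=
     (M / fine (@ball_volume R n))%:E * radial_measure c n A)%E.
Proof.
move=> n0 mN mT M0 N0 H A mA.
have wy := @ball_volume_lty R n; have w0 := @ball_volume_gt0 R n.
have wf : @ball_volume R n \is a fin_num by rewrite ge0_fin_numE// ltW.
set w := fine _; have w0' : 0 < w by rewrite fine_gt0// w0.
have [e [ec ende er]] := radius_lt_exhaustion c.
pose S k := T `&` [set t | (N t <= e k)%R /\ A (N t)].
have mS k : measurable (S k).
  apply: measurableI => //.
  rewrite (_ : [set t | _] = N @^-1` (`]-oo, e k]%classic `&` A)).
    by apply: measurable_preimageT => //; exact: measurableI.
  by apply/seteqP; split => t /=; rewrite in_itv.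
have -> : T `&` [set t | radius_lt c (N t) /\ A (N t)] = \bigcup_k S k.
  apply/seteqP; split => [t [Tt [/er[k Ntk] ANt]]|t [k _ [Tt [/= Ntk ANt]]]].
    by exists k.
  split => //; split => //; move: (ec k); case: c {H ec er} => //= e1.
  exact: le_lt_trans e1.
have SM k : (@lebesgue_measure R (S k) <= (M / w)%:E * radial_measure c n A)%E.
  apply: branch_truncated => //.
  - by rewrite divr_ge0// ltW.
  - exact: radial_measure_lty.
  move=> p q t t' pq qe Tt Tt' /andP[pt tq] /andP[pt' tq'] tt'.
  have q0 : 0 < q by apply: lt_le_trans tq; exact: N0.
  have qc : radius_lt c q.
    by move: (ec k); case: c {H ec er} => //= e1; exact: le_lt_trans e1.
  (* [branch_truncated] also asks for negative [p]; raising [p] to max(p, 0) loses no parameter,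
     because N > 0 on [T]. *)
  have p'0 : 0 <= Num.max p 0 by rewrite le_max lexx orbT.
  have p'q : Num.max p 0 < q by rewrite gt_max pq.
  have tt : ((t' - t)%:E <= (M / w)%:E * radial_measure c n `](Num.max p 0)%R, q]%classic)%E.
    apply: le_trans (_ : ((M / w)%:E * ((radial_weight c (Num.max p 0) *
      (q ^+ n - (Num.max p 0) ^+ n))%:E * ball_volume n) <= _)%E); last first.
      apply: lee_wpmul2l; first by rewrite lee_fin divr_ge0// ltW.
      by apply: radial_measure_ge => //; rewrite p'0 ltW.
    rewrite -(fineK wf) -!EFinM lee_fin -/w mulrAC -mulrA mulfK ?gt_eqF//.
    by apply: H => //; rewrite gt_max ?pt ?pt' N0.
  apply: (le_trans tt); apply: lee_wpmul2l; first by rewrite lee_fin divr_ge0// ltW.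
  apply: le_measure; rewrite ?inE//.
  by move=> r /=; rewrite !in_itv/= gt_max => /andP[/andP[-> _] ->].
have cvS := @nondecreasing_cvg_mu _ _ _ (@lebesgue_measure R) S mS
  (bigcupT_measurable _ mS).
have ndS : nondecreasing_seq S.
  move=> k m km; apply/subsetPset => t [Tt [/= Ntk ANt]].
  by split => //; split => //=; rewrite (le_trans Ntk)// ende.
rewrite -(cvg_lim _ (cvS ndS))//; apply: lime_le.
  by apply/cvg_ex; eexists; exact: cvS.
by apply: nearW => k; exact: SM.
Qed.

End branch.

(** * Elementary inequalities, and the gluing of the two branches around a nearest point *)

Section line_estimates.
Context {R : realType}.

Lemma cos_decrease (a x y : R) : 0 <= a -> a <= x -> x <= y -> y <= pi / 2 ->
  sin a * (y - x) <= cos x - cos y.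
Proof.
move=> a0 ax xy yp.
have [z zxy E] : exists2 z, z \in `[x, y] & cos y - cos x = - sin z * (y - x).
  apply: MVT_segment => //; apply: continuous_subspaceT => t.
  exact: continuous_cos.
have -> : cos x - cos y = sin z * (y - x) by rewrite -opprB E mulNr opprK.
rewrite ler_wpM2r ?subr_ge0//.
move: zxy; rewrite in_itv/= => /andP[xz zy].
have az : a <= z by exact: le_trans xz.
have zp : z <= pi / 2 by exact: le_trans yp.
have p0 : 0 <= pi / 2 :> R by rewrite divr_ge0// pi_ge0.
by rewrite leNgt ltr_sin ?in_itv/= -?leNgt//; apply/andP; split; lra.
Qed.

(** sin a = 2 cos(a/2) sin(a/2) >= a cos(a/2)^2 = a (1 + cos a) / 2, by the mean value theorem for
    sin(a/2), and cos a >= 0. *)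
Lemma half_le_sin (a : R) : 0 <= a <= pi / 2 -> a / 2 <= sin a.
Proof.
move=> /andP[a0 ap].
have c0 : 0 <= cos a.
  by apply: cos_ge0_pihalf; rewrite ap andbT (le_trans _ a0)// oppr_le0 divr_ge0// pi_ge0.
have aE : a = (a / 2) *+ 2 by lra.
have [z zxy E] : exists2 z, z \in `[0, a / 2] & sin (a / 2) - sin 0 = cos z * (a / 2 - 0).
  apply: MVT_segment; first lra.
  by apply: continuous_subspaceT => t; exact: continuous_sin.
move: E; rewrite sin0 !subr0 => E.
move: zxy; rewrite in_itv/= => /andP[z0 za].
have cz : cos (a / 2) <= cos z.
  by rewrite leNgt ltr_cos ?in_itv/= -?leNgt//; apply/andP; split; lra.
have ca : cos a = cos (a / 2) ^+ 2 *+ 2 - 1 by rewrite {1}aE cos_mulr2n.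
have c20 : 0 <= cos (a / 2).
  by apply: cos_ge0_pihalf; apply/andP; split; lra.
have -> : sin a = (cos (a / 2) * sin (a / 2)) *+ 2 by rewrite {1}aE sin_mulr2n.
rewrite E; apply: (@le_trans _ _ (a * (cos (a / 2) * cos (a / 2)))).
  by rewrite ler_wpM2l//; move: ca; rewrite expr2; lra.
have -> : (cos (a / 2) * (cos z * (a / 2))) *+ 2 = a * (cos (a / 2) * cos z) by field.
by rewrite ler_wpM2l// ler_wpM2l.
Qed.

(** Since p^n <= q^n. It reduces the volume of a shell to q^2 - p^2, the quantity that is explicit
    along a geodesic. *)
Lemma ler_power_diff n (p q : R) : 0 <= p <= q ->
  q ^+ n * (q ^+ 2 - p ^+ 2) <= q ^+ n.+2 - p ^+ n.+2.
Proof.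
move=> /andP[p0 pq]; have q0 := le_trans p0 pq.
rewrite mulrBr -exprD addn2 lerD2l lerN2 -addn2 exprD ler_wpM2r ?exprn_ge0//.
by rewrite lerXn2r ?nnegrE.
Qed.

(** [x0] is the parameter of a nearest point and [D] the range of distances to it where the growth
    of the radius is used: [a, +oo[ on a line, [a, pi/2] on a great circle. The central interval
    costs 2 a, and each side is one application of [radial_branch]. *)
Lemma two_sided_estimate c n (N g : R -> R) (D : set R) (x0 a M : R) :
  (0 < n)%N -> measurable_fun setT N -> measurable D -> 0 <= M -> 0 <= a ->
  (forall t, N t = g `|t - x0|) -> (forall x, D x -> 0 < g x) ->
  (forall p q x y, 0 <= p -> p < q -> radius_lt c q -> D x -> D y ->
    p < g x <= q -> p < g y <= q -> x <= y ->
    y - x <= M * (radial_weight c p * (q ^+ n - p ^+ n))) ->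
  forall A, measurable A ->
    (@lebesgue_measure R ([set t | `|t - x0| < a \/ D `|t - x0|]%R `&`
        [set t | radius_lt c (N t) /\ A (N t)]) <=
     (2 * a)%:E + (2 * (M / fine (@ball_volume R n)))%:E * radial_measure c n A)%E.
Proof.
move=> n0 mN mD M0 a0 NE g0 H A mA.
have mabs : measurable_fun setT (fun t : R => `|t - x0|).
  by apply: measurableT_comp => //; exact: measurable_funB.
have mDp : measurable ((fun t : R => `|t - x0|) @^-1` D) by exact: measurable_preimageT.
pose Tp := `[x0, +oo[%classic `&` (fun t : R => `|t - x0|) @^-1` D.
pose Tm := `]-oo, x0]%classic `&` (fun t : R => `|t - x0|) @^-1` D.
have mTp : measurable Tp by exact: measurableI.
have mTm : measurable Tm by exact: measurableI.
pose Q := [set t | radius_lt c (N t) /\ A (N t)].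
have mQ : measurable Q.
  rewrite /Q; case: c {H Q} => /=.
    rewrite (_ : [set t | _] = N @^-1` A); first exact: measurable_preimageT.
    by apply/seteqP; split => t /=; tauto.
  rewrite (_ : [set t | _] = N @^-1` (`]-oo, 1[%classic `&` A)).
    by apply: measurable_preimageT => //; exact: measurableI.
  by apply/seteqP; split => t /=; rewrite in_itv.
have bp : (@lebesgue_measure R (Tp `&` Q) <=
    (M / fine (@ball_volume R n))%:E * radial_measure c n A)%E.
  apply: radial_branch => // [t [_ Dt]|p q t t' p0 pq qc].
    by rewrite NE g0.
  move=> [/=]; rewrite in_itv/= andbT => xt Dt [/=]; rewrite in_itv/= andbT => xt' Dt'.
  rewrite !NE => pt pt' tt'.
  have := H p q _ _ p0 pq qc Dt Dt' pt pt'.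
  by rewrite !ger0_norm ?subr_ge0// lerD2r opprB addrA subrK; exact.
(* On the left of [x0] the distance |t - x0| decreases in t, so t and t' exchange roles. *)
have bm : (@lebesgue_measure R (Tm `&` Q) <=
    (M / fine (@ball_volume R n))%:E * radial_measure c n A)%E.
  apply: radial_branch => // [t [_ Dt]|p q t t' p0 pq qc].
    by rewrite NE g0.
  move=> [/=]; rewrite in_itv/= => xt Dt [/=]; rewrite in_itv/= => xt' Dt'.
  rewrite !NE => pt pt' tt'.
  have := H p q _ _ p0 pq qc Dt' Dt pt' pt.
  rewrite !ler0_norm ?subr_le0// lerN2 lerD2r => /(_ tt').
  by apply: le_trans; lra.
pose B := `]x0 - a, x0 + a[%classic.
have bB : (@lebesgue_measure R B <= (2 * a)%:E)%E.
  rewrite (@lebesgue_measure_itv R `]x0 - a, x0 + a[)/= lte_fin.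
  by case: ifP => _; rewrite ?lee_fin -?EFinD ?lee_fin; lra.
have mB : measurable B by exact: measurable_itv.
have mTpQ : measurable (Tp `&` Q) by exact: measurableI.
have mTmQ : measurable (Tm `&` Q) by exact: measurableI.
have mTQ : measurable ((Tp `&` Q) `|` (Tm `&` Q)) by exact: measurableU.
apply: (@le_trans _ _ (@lebesgue_measure R (B `|` (Tp `&` Q `|` Tm `&` Q)))).
  apply: le_measure; rewrite ?inE.
  - apply: measurableI => //.
    rewrite (_ : [set t | _] = (fun t : R => `|t - x0|) @^-1` (`]-oo, a[%classic `|` D)).
      by apply: measurable_preimageT => //; exact: measurableU.
    by apply/seteqP; split => t /=; rewrite in_itv.
  - exact: (@measurableU _ R).
  - move=> t [/= [ta|Dt] Qt]; first by left; rewrite /B/= in_itv/= -ltr_distl.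
    by right; have [xt|/ltW xt] := leP x0 t; [left|right]; split => //; split => //;
      rewrite /= in_itv/= ?andbT.
apply: le_trans (@measureU2 _ _ _ (@lebesgue_measure R) _ _ mB mTQ) _.
apply: leeD => //; apply: le_trans (@measureU2 _ _ _ (@lebesgue_measure R) _ _ mTpQ mTmQ) _.
by rewrite mulr_natl mulr2n EFinD ge0_muleDl ?leeD// lee_fin divr_ge0// fine_ge0.
Qed.

End line_estimates.

(** * Measure of radial sets on lines and on great circles *)

Section model_lines.
Context {R : realType}.

Lemma scaled_sum_le (x y C a M : R) (m : \bar R) : (0 <= m)%E -> 0 <= a ->
  0 <= M -> x <= C -> y <= C ->
  ((x * a)%:E + (y * M)%:E * m <= C%:E * (a%:E + M%:E * m))%E.
Proof.
move=> m0 a0 M0 xC yC; rewrite muleDr//.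
rewrite muleA -!EFinM leeD//.
  by rewrite lee_fin ler_wpM2r.
by apply: lee_wpmul2r => //; rewrite lee_fin ler_wpM2r.
Qed.

(** For a <= x <= y, (g y)^2 - (g x)^2 = (y - x) (y + x) >= a (y - x), and q >= g y >= a. With
    [ler_power_diff] this gives M = a^-(n+1) in dimension n + 2. *)
Lemma euclidean_line_estimate n : exists2 C : R, 0 < C &
  forall (N : R -> R) (r2 x0 : R), 0 <= r2 ->
    (forall t, N t = Num.sqrt (r2 + (t - x0) ^+ 2)) ->
  forall a A, 0 < a -> measurable A ->
    (@lebesgue_measure R [set t | A (N t)] <=
      C%:E * (a%:E + ((a ^+ n.+1)^-1)%:E * radial_measure Euclidean n.+2 A))%E.
Proof.
have wy := @ball_volume_lty R n.+2; have w0 := @ball_volume_gt0 R n.+2.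
set w := fine (@ball_volume R n.+2); have {wy}w0 : 0 < w by rewrite fine_gt0// w0.
(* 2 comes from the length 2 a of the central interval, 2 / w from the two branches. *)
exists (2 + 2 / w) => [|N r2 x0 r20 NE a A a0 mA]; first by rewrite addr_gt0// divr_gt0.
pose g x := Num.sqrt (r2 + x ^+ 2).
have rx0 x : 0 <= r2 + x ^+ 2 by rewrite addr_ge0// sqr_ge0.
have g0 x : 0 <= g x by exact: sqrtr_ge0.
have g2 x : g x ^+ 2 = r2 + x ^+ 2 by rewrite sqr_sqrtr.
have gx x : 0 <= x -> x <= g x.
  by move=> x0'; rewrite -(@ler_pXn2r _ 2)// ?nnegrE// g2 lerDr.
have mN : measurable_fun setT N.
  rewrite (_ : N = fun t => Num.sqrt (r2 + (t - x0) ^+ 2)); last exact/funext.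
  apply: (measurableT_comp (f := @Num.sqrt R)).
    by apply: continuous_measurable_fun; exact: sqrt_continuous.
  apply: measurable_funD => //; apply: measurable_funX.
  exact: measurable_funB.
have a1 : 0 < a ^+ n.+1 by rewrite exprn_gt0.
have M0 : 0 <= (a ^+ n.+1)^-1 by rewrite invr_ge0 ltW.
have -> : [set t | A (N t)] =
    [set t | `|t - x0| < a \/ `[a, +oo[%classic `|t - x0|] `&`
    [set t | radius_lt Euclidean (N t) /\ A (N t)].
  apply/seteqP; split => t /=; last by move=> [_ []].
  move=> At; split; last by split.
  rewrite in_itv/= andbT; have [?|?] := ltP `|t - x0| a; by [left|right].
apply: le_trans (@two_sided_estimate R Euclidean n.+2 N g _ x0 a
  (a ^+ n.+1)^-1 isT mN (measurable_itv _) M0 (ltW a0) _ _ _ A mA) _.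
- by move=> t; rewrite NE /g real_normK// num_real.
- move=> x; rewrite /= in_itv/= andbT => ax; apply: (lt_le_trans a0).
  exact: le_trans ax (gx _ (le_trans (ltW a0) ax)).
- move=> p q x y p0 pq _; rewrite /= !in_itv/= !andbT => ax ay /andP[px xq] /andP[py yq] xy.
  have q0 : 0 <= q by exact: le_trans (ltW pq).
  have aq : a <= q by apply: le_trans yq; exact: le_trans ay (gx _ (le_trans (ltW a0) ay)).
  have qp : (y - x) * a <= q ^+ 2 - p ^+ 2.
    have gq : g y ^+ 2 <= q ^+ 2 by apply: lerXn2r; rewrite ?nnegrE ?g0.
    have gp : p ^+ 2 <= g x ^+ 2 by apply: lerXn2r; rewrite ?nnegrE ?g0// ltW.
    have : (y - x) * a <= (y - x) * (y + x) by rewrite ler_wpM2l ?subr_ge0//; lra.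
    rewrite -subr_sqr; move: gq gp; rewrite !g2; lra.
  rewrite mul1r mulrC ler_pdivlMr//.
  apply: le_trans (ler_power_diff n _); last by rewrite p0 ltW.
  rewrite (_ : (y - x) * _ = a ^+ n * ((y - x) * a)); last by rewrite exprSr; ring.
  apply: ler_pM => //.
  - by rewrite exprn_ge0// ltW.
  - by rewrite mulr_ge0 ?subr_ge0// ltW.
  - by apply: lerXn2r; rewrite ?nnegrE// ltW.
rewrite -/w (_ : 2 * ((a ^+ n.+1)^-1 / w) = 2 / w * (a ^+ n.+1)^-1); last by ring.
apply: scaled_sum_le => //; rewrite ?(ltW a0)//.
- by rewrite lerDl divr_ge0// ltW.
- by rewrite lerDr.
Qed.

Lemma sqr_cosB_natpi (x : R) (j : nat) : cos (x - j%:R * pi) ^+ 2 = cos x ^+ 2.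
Proof.
elim: j => [|j ih]; first by rewrite mul0r subr0.
rewrite -ih -(subrK pi (x - j%:R * pi)) (cosDpi _) sqrrN.
by congr (cos _ ^+ 2); rewrite -natr1; ring.
Qed.

(* With H, K the heights of the radii p, q: rho sin(a) (y - x) <= H - K, while
   H (H - K) <= q^2 - p^2. *)
Lemma spherical_profile n (rho a M : R) : 0 < rho <= 1 -> 0 < a -> a <= pi / 2 ->
  M = (2 / a) ^+ n.+1 / rho ->
  forall p q x y, 0 <= p -> p < q -> q < 1 -> a <= x -> x <= y -> y <= pi / 2 ->
    p < Num.sqrt (1 - (rho * cos x) ^+ 2) -> Num.sqrt (1 - (rho * cos y) ^+ 2) <= q ->
    y - x <= M * (2 / Num.sqrt (1 - p ^+ 2) * (q ^+ n.+2 - p ^+ n.+2)).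
Proof.
move=> /andP[r0 r1] a0 ap -> p q x y p0 pq q1 ax xy yp pg gq.
have q0 : 0 < q by exact: le_lt_trans pq.
have cy0 : 0 <= cos y by apply: cos_ge0_pihalf; apply/andP; split; lra.
have cx0 : 0 <= cos x by apply: cos_ge0_pihalf; apply/andP; split; lra.
have rc z : (rho * cos z) ^+ 2 <= cos z ^+ 2.
  by rewrite exprMn ler_piMl ?sqr_ge0// expr_le1// ltW.
have g2 z : Num.sqrt (1 - (rho * cos z) ^+ 2) ^+ 2 = 1 - (rho * cos z) ^+ 2.
  by rewrite sqr_sqrtr// subr_ge0 (le_trans (rc z))// cos2sin2 lerBlDr lerDl sqr_ge0.
set H := Num.sqrt (1 - p ^+ 2); set K := Num.sqrt (1 - q ^+ 2).
have H2 : H ^+ 2 = 1 - p ^+ 2.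
  by rewrite [LHS]sqr_sqrtr// subr_ge0 expr_le1// ltW// (lt_trans pq).
have K2 : K ^+ 2 = 1 - q ^+ 2 by rewrite [LHS]sqr_sqrtr// subr_ge0 expr_le1// ltW.
have H0 : 0 < H by rewrite sqrtr_gt0 subr_gt0 expr_lt1// (lt_trans pq).
have K0 : 0 <= K by exact: sqrtr_ge0.
have hH : rho * cos x <= H.
  rewrite -(@ler_pXn2r _ 2)// ?nnegrE ?mulr_ge0 ?(ltW r0) ?(ltW H0)//.
  have : p ^+ 2 <= 1 - (rho * cos x) ^+ 2.
    by rewrite -g2; apply: lerXn2r; rewrite ?nnegrE ?sqrtr_ge0// ltW.
  by rewrite H2; lra.
have hK : K <= rho * cos y.
  rewrite -(@ler_pXn2r _ 2)// ?nnegrE ?mulr_ge0 ?(ltW r0)//.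
  have : 1 - (rho * cos y) ^+ 2 <= q ^+ 2.
    by rewrite -g2; apply: lerXn2r; rewrite ?nnegrE ?sqrtr_ge0// ltW.
  by rewrite K2; lra.
have sa : a / 2 <= sin a by rewrite half_le_sin// ap ltW.
have HK : rho * (a / 2 * (y - x)) <= H - K.
  have := cos_decrease (ltW a0) ax xy yp.
  have : a / 2 * (y - x) <= sin a * (y - x) by rewrite ler_wpM2r// subr_ge0.
  move=> A1 A2; have : rho * (a / 2 * (y - x)) <= rho * (cos x - cos y).
    by rewrite ler_wpM2l ?(ltW r0)//; exact: le_trans A2.
  by rewrite mulrBr; lra.
(* As rho <= 1, the radius is at least that of a great circle through the origin: q >= sin y >= sin
   a >= a / 2. *)
have aq : a / 2 <= q.
  apply: le_trans gq; apply: (@le_trans _ _ (sin y)).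
    apply: (le_trans sa).
    by rewrite leNgt ltr_sin ?in_itv/= -?leNgt//; [lra|apply/andP; split; lra..].
  have sy0 : 0 <= sin y by apply: sin_ge0_pi; apply/andP; split; lra.
  rewrite -(@ler_pXn2r _ 2)// ?nnegrE ?sqrtr_ge0// g2 sin2cos2 lerD2l lerN2.
  exact: rc.
have qp : (a / 2) ^+ n * (q ^+ 2 - p ^+ 2) <= q ^+ n.+2 - p ^+ n.+2.
  apply: le_trans (ler_power_diff n _); last by rewrite p0 ltW.
  rewrite ler_wpM2r//; last by apply: lerXn2r; rewrite ?nnegrE ?(ltW q0)//; lra.
  by rewrite subr_ge0; apply: lerXn2r; rewrite ?nnegrE ?(ltW q0) ?(ltW pq).
have M0 : 0 <= (2 / a) ^+ n.+1 / rho.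
  by rewrite divr_ge0 ?(ltW r0)// exprn_ge0// divr_ge0// ltW.
apply: (@le_trans _ _ ((2 / a) ^+ n.+1 / rho *
  (2 / H * ((a / 2) ^+ n * (q ^+ 2 - p ^+ 2))))); last first.
  by rewrite ler_wpM2l// ler_wpM2l// divr_ge0// ltW.
(* As K >= 0, H + K >= H: the weight 2 / H absorbs the second factor, and H - K is bounded below by
   [HK]. *)
have -> : q ^+ 2 - p ^+ 2 = (H - K) * (H + K) by rewrite -subr_sqr H2 K2; ring.
have -> : (2 / a) ^+ n.+1 / rho * (2 / H * ((a / 2) ^+ n * ((H - K) * (H + K)))) =
    ((2 / a) * (a / 2)) ^+ n * (2 / (a / 2 * rho) * ((H - K) * ((H + K) / H))).
  rewrite exprS [in RHS]exprMn; move: ((2 / a) ^+ n) ((a / 2) ^+ n) => u v.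
  by field; rewrite !gt_eqF.
rewrite (_ : 2 / a * (a / 2) = 1) ?expr1n ?mul1r; last by field; rewrite gt_eqF.
have HK0 : 0 <= H - K.
  apply: le_trans HK; rewrite mulr_ge0 ?(ltW r0)// mulr_ge0 ?subr_ge0//.
  by rewrite divr_ge0// ltW.
have HK1 : H - K <= (H - K) * ((H + K) / H).
  by rewrite ler_peMr// ler_pdivlMr// mul1r lerDl.
have ar0 : 0 < a / 2 * rho by rewrite mulr_gt0// divr_gt0.
rewrite mulrAC ler_pdivlMr//.
have : rho * (a / 2 * (y - x)) <= (H - K) * ((H + K) / H) by exact: le_trans HK1.
lra.
Qed.

(** The radius is symmetric about each x0 + k pi, so it is treated in windows of half-width pi / 2
    around these parameters, each by [two_sided_estimate]. *)
Lemma spherical_line_estimate n : exists2 C : R, 0 < C &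
  forall (N : R -> R) (rho x0 : R), 0 < rho <= 1 -> - pi <= x0 <= pi ->
    (forall t, N t = Num.sqrt (1 - (rho * cos (t - x0)) ^+ 2)) ->
  forall a A, 0 < a -> measurable A ->
    (rho%:E * @lebesgue_measure R (`[0%R, (2 * pi)%R[ `&` [set t | (N t < 1)%R /\ A (N t)]) <=
      C%:E * (a%:E + ((a ^+ n.+1)^-1)%:E * radial_measure Spherical n.+2 A))%E.
Proof.
have wy := @ball_volume_lty R n.+2; have w0 := @ball_volume_gt0 R n.+2.
set w := fine (@ball_volume R n.+2); have {wy}w0 : 0 < w by rewrite fine_gt0// w0.
(* 10 is 5 windows times 2 branches; the power of 2 comes from the bounds by a / 2 in
   [spherical_profile]. *)
pose L : R := 10 * 2 ^+ n.+1 / w.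
have L0 : 0 <= L by rewrite divr_ge0 ?mulr_ge0 ?exprn_ge0// ltW.
exists (10 + L) => [|N rho x0 rho01 x0pi NE a A a0 mA]; first by rewrite ltr_wpDr.
have /andP[r0 r1] := rho01; have /andP[x0l x0u] := x0pi.
have pi0 : 0 <= pi :> R by exact: pi_ge0.
have m0 : (0 <= radial_measure Spherical n.+2 A)%E by exact: measure_ge0.
have a1 : 0 < a ^+ n.+1 by rewrite exprn_gt0.
have mN : measurable_fun setT N.
  rewrite (_ : N = fun t => Num.sqrt (1 - (rho * cos (t - x0)) ^+ 2)); last exact/funext.
  apply: (measurableT_comp (f := @Num.sqrt R)).
    by apply: continuous_measurable_fun; exact: sqrt_continuous.
  apply: measurable_funB => //; apply: measurable_funX; apply: measurable_funM => //.
  apply: (measurableT_comp (f := @cos R)).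
    by apply: continuous_measurable_fun; exact: continuous_cos.
  exact: measurable_funB.
pose Q := [set t | radius_lt Spherical (N t) /\ A (N t)].
have mQ : measurable Q.
  rewrite (_ : Q = N @^-1` (`]-oo, 1[%classic `&` A)).
    by apply: measurable_preimageT => //; exact: measurableI.
  by apply/seteqP; split => t /=; rewrite in_itv.
rewrite -/Q.
(* For large a the whole circle is short enough: its length is 2 pi < 4 a. *)
have [ap|ap] := leP a (pi / 2); last first.
  apply: (@le_trans _ _ ((10 * a)%:E + (L * (a ^+ n.+1)^-1)%:E *
    radial_measure Spherical n.+2 A)%E); last first.
    by apply: scaled_sum_le; rewrite ?invr_ge0 ?(ltW a0) ?(ltW a1)//; lra.
  apply: (@le_trans _ _ (10 * a)%:E); last first.
    by rewrite leeDl// mule_ge0// lee_fin mulr_ge0// invr_ge0 ltW.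
  apply: (@le_trans _ _ (rho%:E * (2 * pi)%:E)%E); last by rewrite -EFinM lee_fin; nra.
  apply: lee_wpmul2l; first by rewrite lee_fin ltW.
  apply: (@le_trans _ _ (@lebesgue_measure R `[0, 2 * pi[%classic)).
    by apply: le_measure; rewrite ?inE//; exact: measurableI.
  rewrite (@lebesgue_measure_itv R `[0, 2 * pi[)/= lte_fin sube0.
  by case: ifP => // _; rewrite lee_fin mulr_ge0.
(* n factors 2 / a come from q >= a / 2 and one from sin a >= a / 2; the division by rho is paid for
   by the factor rho of the conclusion. *)
pose M := (2 / a) ^+ n.+1 / rho.
have M0 : 0 <= M by rewrite divr_ge0 ?(ltW r0)// exprn_ge0// divr_ge0// ltW.
pose ctr (j : nat) := x0 - pi + j%:R * pi.
pose S j := [set t | `|t - ctr j| < a \/ `[a, pi / 2]%classic `|t - ctr j|] `&` Q.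
pose g x := Num.sqrt (1 - (rho * cos x) ^+ 2).
have NgE j t : N t = g `|t - ctr j|.
  rewrite NE /g cos_norm !exprMn; congr (Num.sqrt (1 - _ * _)).
  rewrite (_ : t - ctr j = (t - x0 + pi) - j%:R * pi); last by rewrite /ctr; ring.
  by rewrite sqr_cosB_natpi (cosDpi _) sqrrN.
have mS j : measurable (S j).
  apply: measurableI => //.
  rewrite (_ : [set t | _] = (fun t : R => `|t - ctr j|) @^-1`
    (`]-oo, a[%classic `|` `[a, pi / 2]%classic)).
    apply: measurable_preimageT; last exact: measurableU.
    by apply: measurableT_comp => //; exact: measurable_funB.
  by apply/seteqP; split => t /=; rewrite in_itv.
have bS j : (@lebesgue_measure R (S j) <=
    (2 * a)%:E + (2 * (M / w))%:E * radial_measure Spherical n.+2 A)%E.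
  apply: (@two_sided_estimate R Spherical n.+2 N g) => //.
  - exact: ltW.
  - move=> x; rewrite /= in_itv/= => /andP[ax xp].
    rewrite sqrtr_gt0 subr_gt0 exprMn.
    have sx : 0 < sin x ^+ 2.
      by rewrite exprn_gt0// sin_gt0_pi//; apply/andP; split; lra.
    apply: (@le_lt_trans _ _ (cos x ^+ 2)); last by move: (cos2Dsin2 x); lra.
    by rewrite ler_piMl ?sqr_ge0// expr_le1// ltW.
  - move=> p q x y p0 pq q1; rewrite /= !in_itv/= => /andP[ax _] /andP[_ yp].
    move=> /andP[pg _] /andP[_ gq] xy.
    exact: (@spherical_profile n rho a M rho01 a0 ap erefl).
have cover : `[0, 2 * pi[%classic `&` Q `<=` \big[setU/set0]_(j < 5) S j.
  move=> t [/=]; rewrite in_itv/= => /andP[t0 t1] Qt.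
  (* t - x0 lies in [-pi, 3 pi[, so the five centers x0 - pi, ..., x0 + 3 pi suffice. *)
  have [j j5 tj] : exists2 j, (j < 5)%N & `|t - ctr j| <= pi / 2.
    have [h0|h0] := leP (t - x0) (- (pi / 2)).
      by exists 0%N => //; rewrite ler_distlC /ctr mul0r; apply/andP; split; lra.
    have [h1|h1] := leP (t - x0) (pi / 2).
      by exists 1%N => //; rewrite ler_distlC /ctr mul1r; apply/andP; split; lra.
    have [h2|h2] := leP (t - x0) (pi * 3 / 2).
      by exists 2%N => //; rewrite ler_distlC /ctr; apply/andP; split; lra.
    have [h3|h3] := leP (t - x0) (pi * 5 / 2).
      by exists 3%N => //; rewrite ler_distlC /ctr; apply/andP; split; lra.
    by exists 4%N => //; rewrite ler_distlC /ctr; apply/andP; split; lra.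
  rewrite -bigcup_mkord; exists j => //; split => //=.
  by rewrite in_itv/= tj andbT; have [?|?] := ltP `|t - ctr j| a; [left|right].
have total : (@lebesgue_measure R (`[0%R, (2 * pi)%R[ `&` Q) <=
    (10 * a)%:E + (10 * (M / w))%:E * radial_measure Spherical n.+2 A)%E.
  apply: (@le_trans _ _ (\sum_(j < 5) @lebesgue_measure R (S j))%E).
    apply: (@content_subadditive _ _ _ (@lebesgue_measure R) _ S) => //.
      by move=> j _; exact: mS.
    exact: (@measurableI _ R).
  apply: (@le_trans _ _ (\sum_(j < 5) ((2 * a)%:E + (2 * (M / w))%:E *
      radial_measure Spherical n.+2 A))%E); first by apply: lee_sum => j _; exact: bS.
  have M1 : 0 < M / w by rewrite divr_gt0// divr_gt0// exprn_gt0// divr_gt0.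
  move: m0; case: (radial_measure _ _ _) => // [m _|_]; last first.
    by rewrite [leRHS](_ : _ = +oo)%E ?leey// gt0_muley ?addey// lte_fin mulr_gt0.
  by rewrite !big_ord_recl big_ord0 -!EFinM -!EFinD lee_fin; lra.
apply: (@le_trans _ _ (rho%:E * ((10 * a)%:E + (10 * (M / w))%:E *
    radial_measure Spherical n.+2 A))%E).
  have rE0 : (0 <= rho%:E)%E by rewrite lee_fin ltW.
  exact: (lee_wpmul2l rE0 total).
apply: (@le_trans _ _ ((10 * a)%:E + (L * (a ^+ n.+1)^-1)%:E *
    radial_measure Spherical n.+2 A)%E); last first.
  by apply: scaled_sum_le; rewrite ?invr_ge0 ?(ltW a0) ?(ltW a1)//; lra.
rewrite muleDr// muleA -!EFinM.
apply: leeD; first by rewrite lee_fin; nra.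
apply: lee_wpmul2r => //; rewrite lee_fin le_eqVlt; apply/orP; left; apply/eqP.
by rewrite /L /M exprMn exprVn; field; rewrite !gt_eqF.
Qed.

End model_lines.

(** * Layer cake formula and Lorentz norm *)

Section layer_cake.
Context {R : realType}.

Lemma measurable_nonincreasing (h : R -> \bar R) :
  {homo h : x y / x <= y >-> (y <= x)%E} -> measurable_fun setT h.
Proof.
move=> hd _; apply: (measurability _ (ErealGenOInfty.measurableE R)) => //.
move=> _ [_ [r ->] <-]; rewrite setTI; apply: is_interval_measurable.
move=> x y /= _; rewrite !in_itv/= !andbT => ry z /andP[_ zy].
by rewrite in_itv/= andbT (lt_le_trans ry)//; exact: hd.
Qed.

Context d (T : measurableType d) (m : {sigma_finite_measure set T -> \bar R}).
Variables (w g : T -> \bar R).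
Hypotheses (mw : measurable_fun setT w) (mg : measurable_fun setT g).
Hypotheses (w0 : forall x, (0 <= w x)%E) (g0 : forall x, (0 <= g x)%E).

(** The mass of {g >= s} for the measure of density [w], set to 0 for s <= 0 so that s can run over
    all of R. The inequality is non-strict because [le_generalized_inverse] bounds a rearrangement
    in that form. *)
Definition upper_level (s : R) : \bar R :=
  (\int[m]_x (w x * (\1_[set y : T | (0 < s)%R /\ (s%:E <= g y)%E] x)%:E))%E.

Let F (z : T * measurableTypeR R) : \bar R :=
  (w z.1 * (\1_[set u : T * measurableTypeR R | (0 < u.2)%R /\ (u.2%:E <= g u.1)%E] z)%:E)%E.

Let F0 z : (0 <= F z)%E.
Proof. by rewrite /F mule_ge0// lee_fin. Qed.

Let mF : measurable_fun setT F.
Proof.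
apply: emeasurable_funM; first exact: measurableT_comp.
apply/measurable_EFinP; apply: measurable_indic.
rewrite (_ : [set u | _] = (@snd T (measurableTypeR R)) @^-1` `]0, +oo[%classic `&`
   (setT `&` [set u : T * measurableTypeR R | (u.2%:E <= g u.1)%E])).
  apply: measurableI.
    by apply: measurable_preimageT => //; exact: (@measurable_itv R `]0, +oo[).
  apply: measurable_lee => //.
    by apply: measurableT_comp => //; exact: measurable_snd.
  by apply: measurableT_comp => //.
by rewrite setTI; apply/seteqP; split => u /=; rewrite in_itv/= andbT.
Qed.

Lemma measurable_upper_level : measurable_fun setT upper_level.
Proof.
by have := @measurable_fun_fubini_tonelli_G _ _ _ _ _ m F mF F0.
Qed.

Lemma upper_level_ge0 s : (0 <= upper_level s)%E.
Proof. by apply: integral_ge0 => x _; rewrite mule_ge0// lee_fin. Qed.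

(** Tonelli: for fixed x, the set of s with 0 < s <= g x has length g x, also when g x is
    infinite. *)
Lemma layer_cake :
  (\int[m]_x (w x * g x) = \int[@lebesgue_measure R]_s upper_level s)%E.
Proof.
rewrite -(@fubini_tonelli _ _ _ _ _ m (@lebesgue_measure R) F mF F0).
apply: eq_integral => x _; rewrite /F/=.
rewrite (_ : (fun y => _) = (fun s => w x *
  (\1_[set s : R | (0 < s)%R /\ (s%:E <= g x)%E] s)%:E)%E); last first.
  by apply/funext => s; rewrite !indicE.
have mI : measurable [set s : R | (0 < s)%R /\ (s%:E <= g x)%E].
  rewrite (_ : [set s | _] = `]0, +oo[%classic `&` (setT `&` [set s : R | (s%:E <= g x)%E])).
    by apply: measurableI => //; exact: measurable_lee.
  by rewrite setTI; apply/seteqP; split => s /=; rewrite in_itv/= andbT.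
rewrite ge0_integralZl//; last first.
  by apply/measurable_EFinP; exact: measurable_indic.
congr (_ * _)%E; rewrite integral_indic// setIT.
have := g0 x; case: (g x) => [r r0|_|//].
- rewrite (_ : [set s | _] = `]0, r]%classic); last first.
    by apply/seteqP; split => s /=; rewrite in_itv/= lee_fin => /andP.
  by rewrite [RHS]lebesgue_measure_oc// subr0.
- rewrite (_ : [set s | _] = `]0, +oo[%classic); last first.
    by apply/seteqP; split => s /=; rewrite in_itv/= andbT ?leey// => -[].
  by rewrite [RHS](@lebesgue_measure_itv R `]0, +oo[)/= ltry.
Qed.

End layer_cake.

(** * Level sets of the decreasing rearrangement, and the choice of a *)

Section rearrangement.
Context {R : realType}.
Implicit Types (lev : R -> \bar R).

(* [rearrangement c f], for [lev] the distribution function of |f|. *)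
Definition generalized_inverse lev (t : R) : \bar R :=
  ereal_inf [set s%:E | s in [set s : R | 0 <= s /\ (lev s <= t%:E)%E]].

Lemma generalized_inverse_ge0 lev t : (0 <= generalized_inverse lev t)%E.
Proof. by apply: le_ereal_inf_tmp => _ [s [s0 _] <-]; rewrite lee_fin. Qed.

Lemma measurable_generalized_inverse lev : measurable_fun setT (generalized_inverse lev).
Proof.
apply: measurable_nonincreasing => x y xy.
apply: ereal_inf_le_tmp => _ [s [s0 sx] <-]; exists s => //; split=> //.
by rewrite (le_trans sx)// lee_fin.
Qed.

Lemma le_generalized_inverse lev s d t :
  (forall s', 0 <= s' -> s' < s -> (d%:E <= lev s')%E) -> t < d ->
  (s%:E <= generalized_inverse lev t)%E.
Proof.
move=> H td; apply: le_ereal_inf_tmp => _ [s' [s'0 s't] <-]; rewrite lee_fin leNgt.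
apply/negP => /(H _ s'0) /le_trans /(_ s't).
by rewrite lee_fin leNgt td.
Qed.

(** t^(p-1), split as in the Lorentz norm and extended by 0 so that [layer_cake] applies over R. *)
Definition lorentz_weight (p t : R) : \bar R :=
  ((t `^ p * t^-1) * \1_`]0, +oo[ t)%:E.

Lemma measurable_lorentz_weight p : measurable_fun setT (lorentz_weight p).
Proof.
apply/measurable_EFinP.
rewrite (_ : (fun _ => _) = (fun t => (t `^ p * t `^ (- 1)) * \1_`]0, +oo[ t)).
  by do 2! apply: measurable_funM => //; exact: measurable_powR.
apply/funext => t; rewrite indicE.
have [|_] := boolP (t \in _); last by rewrite !mulr0.
by rewrite inE/= in_itv/= andbT => t0; rewrite powR_inv1// ltW.
Qed.

Lemma lorentz_weight_ge0 p t : (0 <= lorentz_weight p t)%E.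
Proof.
rewrite lee_fin indicE; have [|_] := boolP (t \in _); last by rewrite mulr0.
rewrite inE/= in_itv/= andbT mulr1 => t0.
by rewrite mulr_ge0 ?powR_ge0// invr_ge0 ltW.
Qed.

Lemma integral_lorentz_weight (p : R) (h : R -> \bar R) :
  (\int[lebesgue_measure]_(t in `]0%R, +oo[) ((t `^ p)%:E * h t * (t^-1)%:E) =
   \int[@lebesgue_measure R]_t (lorentz_weight p t * h t))%E.
Proof.
rewrite integral_mkcond; apply: eq_integral => t _; rewrite patchE /lorentz_weight indicE.
case: ifP => _; last by rewrite mulr0 mul0e.
by rewrite mulr1 EFinM muleAC.
Qed.

Lemma powR_div_nonincreasing (p t d : R) : 0 <= p <= 1 -> 0 < t -> t <= d ->
  d `^ p * d^-1 <= t `^ p * t^-1.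
Proof.
move=> /andP[p0 p1] t0 td; have d0 := lt_le_trans t0 td.
have E x : 0 < x -> x `^ p * x^-1 = (x `^ (1 - p))^-1.
  move=> x0; rewrite -powRN opprB powRD; last by rewrite (gt_eqF x0) implybT.
  by rewrite powR_inv1// ltW.
rewrite !E// lef_pV2 ?posrE ?powR_gt0//.
by apply: ge0_ler_powR; rewrite ?subr_ge0// nnegrE ltW.
Qed.

(** The rearrangement is at least [s] on ]0, d[, where t^(p-1) >= d^(p-1); this yields d * d^(p-1).
    Against the exact integral d^p / p only a constant is lost. [d] is a real lower bound for the
    distribution function, whose values may be infinite. *)
Lemma upper_level_lorentz (p : R) lev s d : 0 <= p <= 1 -> 0 < s -> 0 < d ->
  (forall s', 0 <= s' -> s' < s -> (d%:E <= lev s')%E) ->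
  ((d `^ p)%:E <=
    upper_level (@lebesgue_measure R) (lorentz_weight p) (generalized_inverse lev) s)%E.
Proof.
move=> p01 s0 d0 H.
apply: (@le_trans _ _ (\int[@lebesgue_measure R]_(t in `]0%R, d[) (d `^ p * d^-1)%:E)%E).
  rewrite integral_cst// [X in (_ * X)%E](@lebesgue_measure_itv R `]0, d[)/=.
  rewrite lte_fin d0 sube0.
  by rewrite -EFinM mulfVK// gt_eqF.
rewrite /upper_level integral_mkcond; apply: ge0_le_integral => //.
- move=> t _; rewrite patchE; case: ifP => // _.
  by rewrite lee_fin mulr_ge0 ?powR_ge0// invr_ge0 ltW.
- by apply/(measurable_restrictT _ _).1 => //.
- apply: emeasurable_funM; first exact: measurable_lorentz_weight.
  apply/measurable_EFinP; apply: measurable_indic.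
  rewrite (_ : [set _ | _] = setT `&` [set y | (s%:E <= generalized_inverse lev y)%E]).
    by apply: measurable_lee => //; exact: measurable_generalized_inverse.
  by rewrite setTI; apply/seteqP; split => y /= => [[]|].
move=> t _; rewrite patchE; case: ifPn => [|_]; last first.
  by rewrite mule_ge0// ?lorentz_weight_ge0// lee_fin.
rewrite inE/= in_itv/= => /andP[t0 td].
rewrite /lorentz_weight !indicE mem_set/=; last by rewrite in_itv/= t0.
rewrite mem_set/=; last by split => //; exact: le_generalized_inverse td.
by rewrite mulr1 mule1 lee_fin powR_div_nonincreasing// ltW.
Qed.

(* The two terms balance at a = m^(1/(n+2)). *)
Lemma optimize_radius n (C : R) (X I m : \bar R) : 0 < C -> (0 <= m)%E -> (0 <= I)%E ->
  (forall a : R, 0 < a -> (X <= C%:E * (a%:E + ((a ^+ n.+1)^-1)%:E * m))%E) ->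
  (forall d : R, 0 < d -> (d%:E <= m)%E -> ((d `^ n.+2%:R^-1)%:E <= I)%E) ->
  (X <= (2 * C)%:E * I)%E.
Proof.
move=> C0 m0 I0 XC dI; have C20 : 0 < 2 * C by rewrite mulr_gt0.
case: m m0 XC dI => [d|_ _ dI|//]; last first.
  (* For infinite m, testing with d = r^(n+2) gives I >= r for every r > 0. *)
  rewrite (_ : I = +oo)%E ?gt0_muley ?leey// ?lte_fin//.
  apply/eqyP => r r0.
  apply: le_trans (dI (r ^+ n.+2) _ _); rewrite ?exprn_gt0 ?leey//.
  by rewrite -(powR_mulrn _ (ltW r0)) -powRrM divff// powRr1// ltW.
rewrite lee_fin le_eqVlt => /predU1P[<- XC _|d0 XC dI].
  apply: (@le_trans _ _ 0%E); last by rewrite mule_ge0// lee_fin ltW.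
  (* For m = 0 no positive a is optimal: a = e / C is sent to 0. *)
  apply/lee_addgt0Pr => e e0; rewrite add0e.
  apply: le_trans (XC (e / C) _) _; first by rewrite divr_gt0.
  by rewrite mule0 adde0 -EFinM lee_fin mulrC divfK// gt_eqF.
pose a := d `^ n.+2%:R^-1; have a0 : 0 < a by rewrite powR_gt0.
have da : d = a ^+ n.+2 by rewrite -(powR_mulrn _ (ltW a0)) -powRrM mulVf// powRr1// ltW.
apply: le_trans (XC a a0) _.
apply: (@le_trans _ _ ((2 * C)%:E * a%:E)%E); last first.
  by apply: lee_wpmul2l; [rewrite lee_fin ltW|exact: dI].
rewrite -!EFinM lee_fin da (exprS a n.+1) (mulrC a) mulrA mulVf ?mul1r; first lra.
by rewrite gt_eqF// exprn_gt0.
Qed.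

End rearrangement.

(** * Radial functions along geodesics *)

Section profile.
Context {R : realType}.
Implicit Types (c : model_space) (n : nat).

Definition row_proj n (x : 'rV[R]_n.+1) : 'rV[R]_n := \row_i x ord0 (lift ord_max i).

Lemma row_snocK n (u : 'rV[R]_n) s : row_proj (row_snoc u s) = u.
Proof. by apply/rowP => i; rewrite mxE row_snoc_lift. Qed.

Lemma row_projK n (x : 'rV[R]_n.+1) : row_snoc (row_proj x) (x ord0 ord_max) = x.
Proof. by have [u {1 3}->] := row_snoc_ex x; rewrite row_snocK. Qed.

Lemma measurable_row_proj n : measurable_fun setT (@row_proj n).
Proof.
apply: measurable_fun_row => i.
rewrite (_ : _ \o _ = row_coor (lift ord_max i)); first exact: measurable_row_coor.
by apply/funext => x; rewrite /row_coor/= mxE.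
Qed.

Lemma measurable_row_snoc d (T : measurableType d) n (u : T -> 'rV[R]_n) (s : T -> R)
    (D : set T) : measurable D -> measurable_fun setT u -> measurable_fun setT s ->
  measurable_fun D (fun t => row_snoc (u t) (s t)).
Proof.
move=> mD mu ms; apply: measurable_funTS; apply: measurable_fun_row => i.
case: (unliftP ord_max i) => [j|] ->.
  rewrite (_ : _ \o _ = row_coor j \o u).
    by apply: measurableT_comp => //; exact: measurable_row_coor.
  by apply/funext => t; rewrite /row_coor/= row_snoc_lift.
rewrite (_ : _ \o _ = s)//.
by apply/funext => t; rewrite /row_coor/= row_snoc_max.
Qed.

Lemma measurable_model c n : measurable (@model R c n).
Proof.
have E : @model R Euclidean n = row_coor ord_max @^-1` [set (1 : R)] by [].
have S : @model R Spherical n = @enorm R n.+1 @^-1` [set (1 : R)] by [].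
case: c; rewrite (E, S).
  by apply: measurable_preimageT => //; exact: measurable_row_coor.
exact: measurable_enorm_preimage.
Qed.

Definition height c (r : R) : R :=
  match c with Euclidean => 1 | Spherical => Num.sqrt (1 - r ^+ 2) end.

(** A measurable section of (u, s) |-> |u| over [radial_domain]: a ray, or half a meridian of the
    upper hemisphere. *)
Definition base_point c n (r : R) : 'rV[R]_n.+2 :=
  row_snoc (r *: delta_mx ord0 ord0) (height c r).

Lemma dot_delta n : dot (delta_mx ord0 ord0) (delta_mx ord0 ord0 : 'rV[R]_n.+1) = 1.
Proof.
rewrite /dot (bigD1 ord0)//= big1 ?addr0 ?mxE ?eqxx ?mulr1// => i i0.
by rewrite !mxE (negPf i0) andbF mulr0.
Qed.

Lemma enorm_delta n (r : R) : 0 <= r ->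
  enorm (r *: delta_mx ord0 ord0 : 'rV[R]_n.+1) = r.
Proof.
move=> r0; rewrite enormZ ger0_norm//.
by rewrite (_ : enorm _ = 1) ?mulr1//; apply/enorm_eq1/dot_delta.
Qed.

Definition radial_domain c : set R := [set r | 0 <= r /\ radius_lt c r].

Lemma measurable_radial_domain c : measurable (radial_domain c).
Proof.
rewrite (_ : radial_domain c = `[0, +oo[%classic `&`
    (if c is Euclidean then setT else `]-oo, 1[%classic)).
  by apply: measurableI => //; case: c.
by apply/seteqP; split => r; rewrite /radial_domain/= in_itv/= andbT; case: c;
  rewrite /= ?in_itv.
Qed.

Lemma model_base_point c n (r : R) : radial_domain c r -> model c (base_point c n r).
Proof.
case: c => /= -[r0 r1]; first by rewrite /base_point row_snoc_max.
apply/enorm_eq1; rewrite /base_point dot_row_snoc -expr2.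
rewrite [X in _ + X]sqr_sqrtr ?subr_ge0 ?expr_le1 ?(ltW r1)//.
by rewrite dotZl dotZr dot_delta mulr1 -expr2 addrC subrK.
Qed.

Lemma measurable_base_point c n (D : set R) : measurable D ->
  measurable_fun D (base_point c n).
Proof.
move=> mD; apply: measurable_row_snoc => //.
  apply: measurable_fun_row => i.
  rewrite (_ : _ \o _ = (fun r : R => r * (delta_mx ord0 ord0 : 'rV[R]_n.+1) ord0 i)).
    exact: measurable_funM.
  by apply/funext => r; rewrite /row_coor/= mxE.
case: c => /=; first exact: measurable_cst.
apply: (measurableT_comp (f := @Num.sqrt R)).
  by apply: continuous_measurable_fun; exact: sqrt_continuous.
by apply: measurable_funB => //; exact: measurable_funX.
Qed.

Definition abs_complex (z : R[i]) : R := ComplexField.Normc.normc z.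

Lemma abs_complexE (z : R[i]) :
  abs_complex z = Num.sqrt (complex.Re z ^+ 2 + complex.Im z ^+ 2).
Proof. by case: z. Qed.

Lemma abs_complex_ge0 z : 0 <= abs_complex z.
Proof. by rewrite abs_complexE sqrtr_ge0. Qed.

Lemma measurable_abs_comp d (T : measurableType d) c n (f : 'rV[R]_n.+1 -> R[i])
    (phi : T -> 'rV[R]_n.+1) (D : set T) :
  measurable D -> measurable_on c f -> measurable_fun D phi -> phi @` D `<=` @model R c n ->
  measurable_fun D (fun t => abs_complex (f (phi t))).
Proof.
move=> mD [mRe mIm] mphi phiD.
rewrite (_ : (fun t => _) = (fun t => Num.sqrt (complex.Re (f (phi t)) ^+ 2 +
   complex.Im (f (phi t)) ^+ 2))); last by apply/funext => t; rewrite abs_complexE.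
apply: (measurableT_comp (f := @Num.sqrt R)).
  by apply: continuous_measurable_fun; exact: sqrt_continuous.
apply: measurable_funD; apply: measurable_funX.
  exact: (measurable_comp (@measurable_model c n) phiD mRe mphi).
exact: (measurable_comp (@measurable_model c n) phiD mIm mphi).
Qed.

(** Read off from [f] on the section and not from the function that [radial] provides, about which
    no measurability is known. *)
Definition profile c n (f : 'rV[R]_n.+2 -> R[i]) : R -> R :=
  (fun r => abs_complex (f (base_point c n r))) \_ (radial_domain c).

Lemma measurable_profile c n (f : 'rV[R]_n.+2 -> R[i]) : measurable_on c f ->
  measurable_fun setT (profile c f).
Proof.
move=> mf; have mD := measurable_radial_domain c.
apply/(measurable_restrictT _ _).1 => //.
apply: (@measurable_abs_comp _ _ c) => //; first exact: measurable_base_point.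
by move=> _ [r Dr <-]; exact: model_base_point.
Qed.

Lemma rdist_origin_euclidean n (u : 'rV[R]_n) :
  rdist Euclidean (origin n) (row_snoc u 1) = enorm u.
Proof.
rewrite /rdist (_ : origin n = row_snoc 0 1).
  rewrite /enorm -[X in _ - X]scale1r -scaleNr -row_snocZ -row_snocD dot_row_snoc.
  rewrite add0r mulr1 subrr mulr0 addr0 scaleN1r; congr Num.sqrt.
  by rewrite -scaleN1r dotZl dotZr mulrA mulrNN !mul1r.
apply/rowP => i; case: (unliftP ord_max i) => [j|] ->.
  by rewrite row_snoc_lift !mxE eqxx/= -(inj_eq val_inj)/= /bump leqNgt ltn_ord/= add0n
    (ltn_eqF (ltn_ord j)).
by rewrite row_snoc_max !mxE !eqxx.
Qed.

Lemma rdist_origin_spherical n (u : 'rV[R]_n) s :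
  rdist Spherical (origin n) (row_snoc u s) = acos s.
Proof.
rewrite /rdist (_ : dot _ _ = s)// /dot (bigD1 ord_max)//= big1 => [|i i0].
  by rewrite mxE !eqxx mul1r row_snoc_max addr0.
by rewrite mxE eqxx/= (negPf i0) mul0r.
Qed.

(** On the sphere, points with the same positive height are at the same distance < pi / 2 from the
    origin, so [radial] identifies their values. Evenness moves a point of negative height to the
    upper hemisphere, and height 0 is excluded by |u| < 1. *)
Lemma abs_radialE c n (f : 'rV[R]_n.+2 -> R[i]) (u : 'rV[R]_n.+1) s :
  sphere_even c f -> radial c f -> model c (row_snoc u s) -> radius_lt c (enorm u) ->
  abs_complex (f (row_snoc u s)) = profile c f (enorm u).
Proof.
move=> evf [ft radf] mx ux.
have Du : radial_domain c (enorm u) by split => //; rewrite sqrtr_ge0.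
rewrite /profile patchE mem_set//; congr abs_complex.
case: c evf radf mx ux Du => evf radf mx ux Du.
  have lty (r : R) : (r%:E < @diameter R Euclidean * (2^-1)%:E)%E.
    by rewrite /= gt0_mulye ?ltry// lte_fin invr_gt0.
  have s1 : s = 1 by move: mx; rewrite /= row_snoc_max.
  rewrite s1 in mx *.
  rewrite (radf _ mx (lty _)) (radf _ (model_base_point n Du) (lty _)).
  by rewrite /base_point !rdist_origin_euclidean enorm_delta// sqrtr_ge0.
have {}ux : enorm u < 1 by [].
have half s' : 0 < s' <= 1 -> ((acos s')%:E < pi%:E * (2^-1)%:E :> \bar R)%E.
  move=> /andP[s0 s1]; rewrite -EFinM lte_fin -acos0.
  have s'1 : -1 <= s' <= 1 by apply/andP; split; lra.
  have z1 : -1 <= (0 : R) <= 1 by apply/andP; split; lra.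
  by rewrite -ltr_cos ?in_itv/= ?acos_ge0 ?acos_lepi// !acosK ?in_itv.
have key u' v s' : 0 < s' -> model Spherical (row_snoc u' s') -> model Spherical (row_snoc v s') ->
    f (row_snoc u' s') = f (row_snoc v s').
  move=> s0 mu mv.
  have s1 : 0 < s' <= 1.
    have s2 : s' ^+ 2 <= 1.
      move/enorm_eq1: mu; rewrite dot_row_snoc -expr2 => E.
      by rewrite -E lerDr dot_ge0.
    by rewrite s0/= -(@expr_le1 _ 2)// ltW.
  have d v' : ((rdist Spherical (origin n.+1) (row_snoc v' s'))%:E <
      @diameter R Spherical * (2^-1)%:E)%E by rewrite rdist_origin_spherical half.
  by rewrite (radf _ mu (d _)) (radf _ mv (d _)) !rdist_origin_spherical.
have ss : s ^+ 2 = 1 - enorm u ^+ 2.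
  by move/enorm_eq1: (mx); rewrite dot_row_snoc sqr_enorm -expr2 => <-; rewrite addrC addKr.
have s0 : s != 0.
  apply/eqP => s0; move: ss ux; rewrite s0 expr0n/= => /esym/eqP.
  rewrite subr_eq0 eq_sym sqrp_eq1 ?sqrtr_ge0// => /eqP ->.
  by rewrite ltxx.
have mb := model_base_point n Du; rewrite /base_point/= -ss sqrtr_sqr in mb *.
have [sp|sn] := ltP 0 s.
  by rewrite ger0_norm ?(ltW sp)// in mb *; exact: key.
have {}sn : s < 0 by rewrite lt_neqAle s0.
rewrite ltr0_norm// in mb *.
have NE : - row_snoc u s = row_snoc (- u) (- s).
  by rewrite -scaleN1r -row_snocZ mulN1r scaleN1r.
have mN : model Spherical (row_snoc (- u) (- s)).
  apply/enorm_eq1; move/enorm_eq1: (mx); rewrite !dot_row_snoc mulrNN => <-.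
  by rewrite -scaleN1r dotZl dotZr mulrA mulrNN !mul1r.
by rewrite -(evf erefl _ mx) NE; apply: key; rewrite ?oppr_gt0.
Qed.

End profile.

(** * The radius as a function of arc length *)

Section geodesic_radius.
Context {R : realType}.
Implicit Types (c : model_space) (n : nat).

Definition equatorial c n (xi : set 'rV[R]_n.+1) : Prop :=
  c = Spherical /\ forall x, xi x -> x ord0 ord_max = 0.

Definition radius_along c n (xi : set 'rV[R]_n.+1) (t : R) : R :=
  enorm (row_proj (along c xi t)).

Lemma along_param c n (xi : set 'rV[R]_n.+1) : Xi1 c xi ->
  exists x v, [/\ unit_tangent c x v, xi = range (geodesic c (x, v)) &
    along c xi = geodesic c (x, v)].
Proof.
move=> [p pP]; have := @getPex _ (parametrizes c xi) (ex_intro _ p pP).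
by rewrite /along; case: (get _) => x v [xv xiE]; exists x, v.
Qed.

Lemma sqr_enorm_row_proj n (x : 'rV[R]_n.+1) :
  enorm (row_proj x) ^+ 2 = dot x x - (x ord0 ord_max) ^+ 2.
Proof. by rewrite sqr_enorm -{3 4}(row_projK x) dot_row_snoc -expr2 addrK. Qed.

Lemma euclidean_radius n (x v : 'rV[R]_n.+1) : unit_tangent Euclidean x v ->
  exists r2 x0, 0 <= r2 /\ forall t,
    enorm (row_proj (geodesic Euclidean (x, v) t)) = Num.sqrt (r2 + (t - x0) ^+ 2).
Proof.
move=> [mx v1 v0]; pose u := row_proj x; pose w := row_proj v.
have xE : x = row_snoc u 1 by rewrite -(row_projK x) mx.
have vE : v = row_snoc w 0 by rewrite -(row_projK v) v0.
have ww : dot w w = 1 by move/enorm_eq1: v1; rewrite vE dot_row_snoc mulr0 addr0.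
(* The squared distance from 0 to the projected line, and the parameter of its nearest point. *)
exists (dot u u - dot u w ^+ 2), (- dot u w); split.
  have := dot_ge0 (u + (- dot u w) *: w).
  by rewrite !(dotDl, dotDr, dotZl, dotZr) ww (dotC w u); lra.
move=> t; rewrite geodesicE xE vE -row_snocZ mulr0 -row_snocD row_snocK.
congr Num.sqrt; rewrite !(dotDl, dotDr, dotZl, dotZr) ww (dotC w u); ring.
Qed.

(** The range of the angle is what limits [spherical_line_estimate] to five windows. *)
Lemma circle_angle_pi (a b : R) : a ^+ 2 + b ^+ 2 = 1 ->
  exists t, [/\ - pi <= t <= pi, a = cos t & b = sin t].
Proof.
move=> /circle_angle[t [-> ->]].
have c1 : -1 <= cos t <= 1 by rewrite cos_geN1 cos_le1.
have p0 : 0 <= pi :> R by exact: pi_ge0.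
have sE : sin (acos (cos t)) = `|sin t| by rewrite sin_acos// -sin2cos2 sqrtr_sqr.
have a0 := acos_ge0 c1; have ap := acos_lepi c1.
have [s0|s0] := leP 0 (sin t).
  exists (acos (cos t)); rewrite acosK ?in_itv// sE ger0_norm//.
  by split => //; apply/andP; split; lra.
exists (- acos (cos t)); rewrite cosN sinN acosK ?in_itv// sE ltr0_norm// opprK.
by split => //; apply/andP; split; lra.
Qed.

(** With a, b the heights of x and v, the height along the circle is a cos t + b sin t = rho cos(t -
    x0), in polar coordinates for (a, b). rho <= 1 is the Bessel inequality for the orthonormal pair
    x, v, and rho = 0 would make the circle equatorial. *)
Lemma spherical_radius n (x v : 'rV[R]_n.+1) : unit_tangent Spherical x v ->
  ~ equatorial Spherical (range (geodesic Spherical (x, v))) ->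
  exists rho x0, [/\ 0 < rho <= 1, - pi <= x0 <= pi,
    (forall t, geodesic Spherical (x, v) t ord0 ord_max = rho * cos (t - x0)) &
    (forall t, enorm (row_proj (geodesic Spherical (x, v) t)) =
      Num.sqrt (1 - (rho * cos (t - x0)) ^+ 2))].
Proof.
move=> [/enorm_eq1 xx /enorm_eq1 vv xv] neq.
set a := x ord0 ord_max; set b := v ord0 ord_max.
have lastE t : geodesic Spherical (x, v) t ord0 ord_max = cos t * a + sin t * b.
  by rewrite geodesicE !mxE.
have ab1 : a ^+ 2 + b ^+ 2 <= 1.
  pose e := origin n : 'rV[R]_n.+1.
  have eE (y : 'rV[R]_n.+1) : dot e y = y ord0 ord_max.
    rewrite /dot (bigD1 ord_max)//= big1 ?addr0 => [|i i0].
      by rewrite mxE !eqxx mul1r.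
    by rewrite mxE eqxx/= (negPf i0) mul0r.
  have ee : dot e e = 1 by rewrite eE mxE !eqxx.
  have := dot_ge0 (e - a *: x - b *: v).
  rewrite -!scaleNr !(dotDl, dotDr, dotZl, dotZr) ee xx vv xv (dotC v x) xv.
  by rewrite (dotC x e) (dotC v e) !eE -/a -/b; lra.
have ab0 : 0 < a ^+ 2 + b ^+ 2.
  rewrite lt_neqAle addr_ge0 ?sqr_ge0// andbT; apply/negP => /eqP/esym/eqP.
  rewrite paddr_eq0 ?sqr_ge0// !sqrf_eq0 => /andP[/eqP a0 /eqP b0].
  by apply: neq; split => // _ [t _ <-]; rewrite lastE a0 b0 !mulr0 addr0.
pose rho := Num.sqrt (a ^+ 2 + b ^+ 2).
have r0 : 0 < rho by rewrite sqrtr_gt0.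
have r2 : rho ^+ 2 = a ^+ 2 + b ^+ 2 by rewrite sqr_sqrtr// ltW.
have [x0 [x0pi ca sb]] := @circle_angle_pi (a / rho) (b / rho) (ltac:(
  by rewrite !expr_div_n -mulrDl r2 mulfV// gt_eqF)).
have cE t : geodesic Spherical (x, v) t ord0 ord_max = rho * cos (t - x0).
  by rewrite lastE cosB -ca -sb; field; rewrite gt_eqF.
exists rho, x0; split => //.
  by rewrite r0/= -(@expr_le1 _ 2) ?r2// ltW.
move=> t; rewrite -cE; apply/eqP; rewrite -(@eqrXn2 _ 2)// ?sqrtr_ge0//.
have dE : dot (geodesic Spherical (x, v) t) (geodesic Spherical (x, v) t) = 1.
  rewrite geodesicE !(dotDl, dotDr, dotZl, dotZr) xx vv (dotC v x) xv.
  by apply: etrans (cos2Dsin2 t); ring.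
rewrite sqr_enorm_row_proj dE sqr_sqrtr// -[X in X - _]dE -sqr_enorm_row_proj.
exact: sqr_ge0.
Qed.

(** The greatest height on the circle is rho, attained at x0, so its distance from the origin is
    acos rho, where the derivative of sin is rho. *)
Lemma derive1_dist_origin_spherical n (x v : 'rV[R]_n.+1) rho x0 : 0 < rho <= 1 ->
  (forall t, geodesic Spherical (x, v) t ord0 ord_max = rho * cos (t - x0)) ->
  derive1 (s_ Spherical) (dist_origin Spherical (range (geodesic Spherical (x, v)))) = rho.
Proof.
move=> /andP[r0 r1] lastE.
have dE y : rdist Spherical (origin n) y = acos (y ord0 ord_max).
  by rewrite -{1}(row_projK y) rdist_origin_spherical.
have bnd t : -1 <= rho * cos t <= 1.
  have := cos_geN1 t; have := cos_le1 t => c1 c2; apply/andP; split; nra.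
have rb : -1 <= rho <= 1 by apply/andP; split; lra.
have -> : dist_origin Spherical (range (geodesic Spherical (x, v))) = acos rho.
  have lb : lbound [set rdist Spherical (origin n) y | y in
      range (geodesic Spherical (x, v))] (acos rho).
    move=> _ [_ [t _ <-] <-]; rewrite dE lastE leNgt; apply/negP.
    rewrite -ltr_cos ?in_itv/= ?acos_ge0 ?acos_lepi// !acosK ?in_itv//=.
    by apply/negP; rewrite -leNgt; have := cos_le1 (t - x0); nra.
  have mem : [set rdist Spherical (origin n) y | y in
      range (geodesic Spherical (x, v))] (acos rho).
    exists (geodesic Spherical (x, v) x0); first by exists x0.
    by rewrite dE lastE subrr cos0 mulr1.
  apply/eqP; rewrite eq_le; apply/andP; split.
    by apply: ge_inf => //; exists (acos rho).
  by apply: lb_le_inf => //; exists (acos rho).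
rewrite (_ : s_ Spherical = @sin R)// derive1E.
have := is_derive_sin (acos rho) => /(@derive_val _ _ _ _ _ _ _) ->.
by rewrite acosK ?in_itv.
Qed.

Lemma derive1_dist_origin_euclidean n (xi : set 'rV[R]_n.+1) :
  derive1 (s_ Euclidean) (dist_origin Euclidean xi) = 1.
Proof. by rewrite (_ : s_ Euclidean = id)// derive1_id. Qed.

(** [nz] excludes zeros in the open windows of half-width pi / 2 around the centers x0 - pi, ..., x0
    + 3 pi. In the range [-pi, 3 pi[ of t - x0, this leaves the four half-integer multiples of pi
    listed in [Z]. *)
Lemma lebesgue_cos_zero (x0 : R) : - pi <= x0 <= pi ->
  @lebesgue_measure R (`[0, 2 * pi[%classic `&` [set t | cos (t - x0) = 0]) = 0%E.
Proof.
move=> /andP[x0l x0u]; have p0 : 0 < pi :> R by exact: pi_gt0.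
have nz (j : nat) (t : R) : cos (t - x0) = 0 -> `|t - x0 + pi - j%:R * pi| < pi / 2 -> False.
  move=> ct; rewrite ltr_norml => jt.
  have := cos_gt0_pihalf jt; rewrite lt_neqAle => /andP[+ _].
  by rewrite eq_sym -sqrf_eq0 sqr_cosB_natpi (cosDpi _) ct sqrrN expr0n eqxx.
pose Z := [set x0 + pi * k | k in [set (-1/2 : R); 1/2; 3/2; 5/2]].
have cZ : countable Z.
  apply: finite_set_countable; apply: finite_image; rewrite !finite_setU.
  by do !split; exact: finite_set1.
apply/eqP; rewrite eq_le measure_ge0 andbT -(countable_lebesgue_measure0 cZ).
have mcos : measurable_fun setT (fun t : R => cos (t - x0)).
  apply: (measurableT_comp (f := @cos R)).
    by apply: continuous_measurable_fun; exact: continuous_cos.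
  exact: measurable_funB.
apply: le_measure; rewrite ?inE.
- apply: (@measurableI _ R) => //.
  exact: (measurable_preimageT mcos (measurable_set1 (0 : R))).
- exact: countable_measurable.
move=> t [/=]; rewrite in_itv/= => /andP[t0 t1] ct.
have mem k : t - x0 = pi * k -> (k = -1/2 \/ k = 1/2 \/ k = 3/2 \/ k = 5/2) -> Z t.
  move=> tk kk; exists k; last by rewrite -tk addrC subrK.
  by move: kk => [|[|[|]]] ->; rewrite /=; tauto.
have nz' (j : nat) : ~~ (`|t - x0 + pi - j%:R * pi| < pi / 2).
  by apply/negP; exact: nz.
have n0 := nz' 0%N; have n1 := nz' 1%N; have n2 := nz' 2%N; have n3 := nz' 3%N.
have n4 := nz' 4%N; rewrite !ltr_norml !negb_and -!leNgt in n0 n1 n2 n3 n4.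
have [h1|h1] := ltP (t - x0) 0.
  apply: (mem (-1/2)); last by left.
  apply: le_anti; apply/andP; split.
    by case/orP: n1 => ?; lra.
  by case/orP: n0 => ?; lra.
have [h2|h2] := ltP (t - x0) pi.
  apply: (mem (1/2)); last by tauto.
  apply: le_anti; apply/andP; split.
    by case/orP: n2 => ?; lra.
  by case/orP: n1 => ?; lra.
have [h3|h3] := ltP (t - x0) (2 * pi).
  apply: (mem (3/2)); last by tauto.
  apply: le_anti; apply/andP; split.
    by case/orP: n3 => ?; lra.
  by case/orP: n2 => ?; lra.
apply: (mem (5/2)); last by tauto.
apply: le_anti; apply/andP; split.
  by case/orP: n4 => ?; lra.
by case/orP: n3 => ?; lra.
Qed.

End geodesic_radius.

(** * From level sets to the integral of |f| along a geodesic *)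

Section geodesic_bound.
Context {R : realType}.
Implicit Types (c : model_space) (n : nat).

(** The null set in the third clause consists of the parameters where the geodesic meets the
    equator, at which the radius gives no information on f. *)
Lemma geodesic_estimate c n : exists2 C : R, 0 < C &
  forall xi : set 'rV[R]_n.+3, Xi1 c xi -> ~ equatorial c xi ->
  exists rho, [/\ 0 < rho, derive1 (s_ c) (dist_origin c xi) = rho,
    @lebesgue_measure R (arc_domain c `&`
      [set t | ~ radius_lt c (radius_along c xi t)]) = 0%E &
    forall a A, 0 < a -> measurable A ->
      (rho%:E * @lebesgue_measure R (arc_domain c `&`
        [set t | radius_lt c (radius_along c xi t) /\ A (radius_along c xi t)]) <=
      C%:E * (a%:E + ((a ^+ n.+1)^-1)%:E * radial_measure c n.+2 A))%E].
Proof.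
case: c.
  have [C C0 HC] := @euclidean_line_estimate R n; exists C => // xi xiX _.
  have [x [v [xv _ al]]] := along_param xiX.
  have [r2 [x0 [r20 NE]]] := euclidean_radius xv.
  exists 1; split=> //; first exact: derive1_dist_origin_euclidean.
    rewrite (_ : [set t | _] = set0) ?setI0 ?measure0//.
    by rewrite -subset0 => t /=; exact.
  move=> a A a0 mA; rewrite mul1e setTI.
  rewrite (_ : [set t | _] = [set t | A (radius_along Euclidean xi t)]); last first.
    by apply/seteqP; split => t /=; tauto.
  by apply: HC r20 _ _ _ a0 mA => t; rewrite /radius_along al.
have [C C0 HC] := @spherical_line_estimate R n; exists C => // xi xiX neq.
have [x [v [xv xiE al]]] := along_param xiX.
have [|rho [x0 [rho01 x0pi lastE NE]]] := spherical_radius xv; first by rewrite -xiE.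
have RE t : radius_along Spherical xi t = Num.sqrt (1 - (rho * cos (t - x0)) ^+ 2).
  by rewrite /radius_along al.
exists rho; split.
- by case/andP: rho01.
- by rewrite xiE; exact: derive1_dist_origin_spherical lastE.
- rewrite -(lebesgue_cos_zero x0pi); congr (lebesgue_measure _).
  apply/seteqP; split => t /= [t2 h]; split => //; move: h; rewrite RE.
    apply: contra_notP => ct.
    rewrite -[ltRHS]sqrtr1 ltr_sqrt// gtrDl oppr_lt0 exprn_even_gt0//=.
    by rewrite mulf_neq0//; [rewrite gt_eqF//; case/andP: rho01|exact/eqP].
  by move=> ->; rewrite mulr0 expr0n subr0 sqrtr1 ltxx.
by move=> a A a0 mA; exact: HC rho01 x0pi RE _ _ a0 mA.
Qed.

Lemma measurable_along c n (xi : set 'rV[R]_n.+1) : Xi1 c xi ->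
  measurable_fun setT (along c xi).
Proof.
move=> /along_param[x [v [_ _ ->]]]; apply: measurable_fun_row => i.
have mc : measurable_fun setT (@cos R).
  by apply: continuous_measurable_fun; exact: continuous_cos.
have ms : measurable_fun setT (@sin R).
  by apply: continuous_measurable_fun; exact: continuous_sin.
rewrite (_ : _ \o _ = match c with
  | Euclidean => fun t => x ord0 i + t * v ord0 i
  | Spherical => fun t => cos t * x ord0 i + sin t * v ord0 i end).
  by case: c; apply: measurable_funD => //; apply: measurable_funM.
by apply/funext => t; rewrite /row_coor/= geodesicE; case: c; rewrite !mxE.
Qed.

Lemma along_model c n (xi : set 'rV[R]_n.+1) t : Xi1 c xi -> model c (along c xi t).
Proof.
move=> /along_param[x [v [[mx /enorm_eq1 vv xv] _ ->]]]; rewrite geodesicE.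
case: c mx xv => /= mx xv; first by rewrite !mxE mx xv mulr0 addr0.
move/enorm_eq1: mx => xx; apply/enorm_eq1.
rewrite !(dotDl, dotDr, dotZl, dotZr) xx vv (dotC v x) xv.
by apply: etrans (cos2Dsin2 t); ring.
Qed.

Lemma measurable_arc_domain c : measurable (@arc_domain R c).
Proof. by case: c => /=. Qed.

Lemma rearrangementE c n (f : 'rV[R]_n.+2 -> R[i]) t :
  sphere_even c f -> radial c f ->
  measurable_on c f ->
  rearrangement c f t = generalized_inverse
    (fun s => radial_measure c n.+1 [set r | s < profile c f r]) t.
Proof.
move=> evf radf mf; rewrite /rearrangement /generalized_inverse.
have mp s : measurable [set r | s < profile c f r].
  rewrite (_ : [set r | _] = profile c f @^-1` `]s, +oo[%classic).
    by apply: measurable_preimageT => //; exact: measurable_profile.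
  by apply/seteqP; split => r /=; rewrite in_itv/= andbT.
congr (ereal_inf (image _ _)); apply/seteqP; split => s /= [s0 h]; split => //; move: h;
  rewrite (@riemannian_radial _ c n.+1 (fun x => s < abs_complex (f x)) _ (mp s))// => u v mx ux;
  by rewrite (abs_radialE evf radf mx ux).
Qed.

Lemma lorentz_normE c n (f : 'rV[R]_n.+2 -> R[i]) :
  sphere_even c f -> radial c f -> measurable_on c f ->
  lorentz_norm c f = ((n.+1%:R^-1)%:E * \int[@lebesgue_measure R]_t
    (lorentz_weight n.+1%:R^-1 t * generalized_inverse
    (fun s => radial_measure c n.+1 [set r | (s < profile c f r)%R]) t))%E.
Proof.
move=> evf radf mf; rewrite /lorentz_norm -integral_lorentz_weight.
by congr (_ * _)%E; apply: eq_integral => t _; rewrite rearrangementE.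
Qed.

(** [layer_cake] is applied twice, to |f| along the geodesic and to its rearrangement with the
    Lorentz weight, so that it suffices to compare the two integrands at each level s. There
    [geodesic_estimate] and [upper_level_lorentz] are the two hypotheses of [optimize_radius]. *)
Lemma radial_line_integral c n : exists2 C : R, 0 < C &
  forall f : 'rV[R]_n.+3 -> R[i], sphere_even c f -> radial c f -> measurable_on c f ->
  forall xi : set 'rV[R]_n.+3, Xi1 c xi -> ~ equatorial c xi ->
  exists rho, [/\ 0 < rho, derive1 (s_ c) (dist_origin c xi) = rho &
    (rho%:E * \int[@lebesgue_measure R]_(t in arc_domain c) (abs_complex (f (along c xi t)))%:E <=
     C%:E * lorentz_norm c f)%E].
Proof.
(* 2 C is the constant of [optimize_radius]; n + 2 cancels the inverse of the dimension in the
   Lorentz norm. *)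
have [C C0 HC] := @geodesic_estimate c n; exists (2 * C * n.+2%:R).
  by rewrite !mulr_gt0.
move=> f evf radf mf xi xiX neq; have [rho [r0 dE Z0 est]] := HC xi xiX neq.
exists rho; split => //.
pose h t := abs_complex (f (along c xi t)).
have mh : measurable_fun setT h.
  apply: (measurable_abs_comp _ mf) => //; first exact: measurable_along.
  by move=> _ [t _ <-]; exact: along_model.
have mdom := measurable_arc_domain c.
pose w t : \bar R := (\1_(@arc_domain R c) t)%:E.
have mw : measurable_fun setT w by apply/measurable_EFinP; exact: measurable_indic.
have w0 t : (0 <= w t)%E by rewrite lee_fin.
have mh' : measurable_fun setT (EFin \o h) by exact/measurable_EFinP.
have h0 t : (0 <= (EFin \o h) t)%E by rewrite lee_fin abs_complex_ge0.
have -> : (\int[@lebesgue_measure R]_(t in arc_domain c) (h t)%:E =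
    \int[@lebesgue_measure R]_t (w t * (EFin \o h) t))%E.
  rewrite integral_mkcond; apply: eq_integral => t _; rewrite patchE /w indicE.
  by case: ifP => _; rewrite ?mul1e ?mul0e.
rewrite (layer_cake (@lebesgue_measure R) mw mh' w0 h0) lorentz_normE//.
pose lev s := radial_measure c n.+2 [set r | s < profile c f r].
have mg := measurable_generalized_inverse lev.
have g0 t : (0 <= generalized_inverse lev t)%E by exact: generalized_inverse_ge0.
pose p : R := n.+2%:R^-1; rewrite -/lev -/p.
have mW := @measurable_lorentz_weight R p; have W0 := @lorentz_weight_ge0 R p.
rewrite (layer_cake (@lebesgue_measure R) mW mg W0 g0).
have m1 := measurable_upper_level (@lebesgue_measure R) mw mh' w0.
have m2 := measurable_upper_level (@lebesgue_measure R) mW mg W0.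
have u1 := upper_level_ge0 (@lebesgue_measure R) (EFin \o h) w0.
have u2 := upper_level_ge0 (@lebesgue_measure R) (generalized_inverse lev) W0.
rewrite -ge0_integralZl//; last by rewrite lee_fin ltW.
rewrite muleA -EFinM mulfK ?pnatr_eq0//.
rewrite -ge0_integralZl//; last by rewrite lee_fin mulr_ge0 ?ltW.
apply: ge0_le_integral => //.
- by move=> s _; rewrite mule_ge0// lee_fin ltW.
- exact: measurable_funeM.
- exact: measurable_funeM.
move=> s _.
have [s0|s0] := leP s 0.
  rewrite {1}/upper_level (eq_integral (cst 0%E)) ?integral0 ?mule0.
    by rewrite mule_ge0// lee_fin mulr_ge0 ?ltW.
  move=> t _; rewrite indicE memNset ?mule0//=.
  by rewrite ltNge s0 => -[].
pose A := [set r | s <= profile c f r].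
have mA : measurable A.
  rewrite (_ : A = profile c f @^-1` `[s, +oo[%classic).
    by apply: measurable_preimageT => //; exact: measurable_profile.
  by apply/seteqP; split => r /=; rewrite in_itv/= andbT.
apply: (@optimize_radius R n C _ _ (radial_measure c n.+2 A)) => //.
  move=> a a0; apply: le_trans (est a A a0 mA).
  apply: lee_wpmul2l; first by rewrite lee_fin ltW.
  pose N := radius_along c xi.
  have mN : measurable_fun setT N.
    apply: measurableT_comp; first exact: measurable_enorm_row.
    by apply: measurableT_comp; [exact: measurable_row_proj|exact: measurable_along].
  have mlt : measurable [set r : R | radius_lt c r].
    rewrite (_ : [set r | _] = if c is Euclidean then setT else `]-oo, 1[%classic).
      by case: (c).
    by case: (c) => //; apply/seteqP; split => r /=; rewrite in_itv.
  have mE : measurable (arc_domain c `&` [set t | radius_lt c (N t) /\ A (N t)]).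
    apply: measurableI => //.
    exact: (measurable_preimageT mN (measurableI _ _ mlt mA)).
  have mZ : measurable (arc_domain c `&` [set t | ~ radius_lt c (N t)]).
    apply: measurableI => //.
    exact: (measurable_preimageT mN (measurableC mlt)).
  have mS : measurable (arc_domain c `&` [set t | s <= h t]).
    apply: measurableI => //.
    rewrite (_ : [set t | _] = h @^-1` `[s, +oo[%classic); first exact: measurable_preimageT.
    by apply/seteqP; split => t /=; rewrite in_itv/= andbT.
  apply: (@le_trans _ _ (@lebesgue_measure R (arc_domain c `&` [set t | s <= h t]))).
    have := @integral_indic _ _ _ (@lebesgue_measure R) _ (@measurableT _ R) _ mS.
    rewrite setIT => <-; rewrite le_eqVlt; apply/orP; left; apply/eqP.
    apply: eq_integral => t _; rewrite /w -EFinM; congr EFin.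
    have b : (t \in [set y | 0 < s /\ (s%:E <= (EFin \o h) y)%E]) =
      (t \in [set t | s <= h t]).
      by apply/idP/idP; rewrite !inE/= lee_fin => // -[].
    rewrite !indicE b in_setI.
    by case: (t \in arc_domain c); rewrite ?mul1r ?mul0r.
  (* The parameters on the equator are split off, as f is not tied to its profile there. *)
  apply: (@le_trans _ _ (@lebesgue_measure R
    ((arc_domain c `&` [set t | ~ radius_lt c (N t)]) `|`
     (arc_domain c `&` [set t | radius_lt c (N t) /\ A (N t)])))).
    apply: le_measure; rewrite ?inE//; first exact: (@measurableU _ R).
    move=> t [/= Dt st]; have [rt|rt] := pselect (radius_lt c (N t)); last by left.
    right; split => //; split => //; apply: (le_trans st); rewrite /h.
    have := along_model t xiX; rewrite -{1 2}(row_projK (along c xi t)) => mx.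
    by rewrite (abs_radialE evf radf mx rt).
  apply: le_trans (@measureU2 _ _ _ (@lebesgue_measure R) _ _ mZ mE) _.
  by rewrite [X in (X + _)%E]Z0 add0e.
move=> d d0 dA; apply: upper_level_lorentz => //.
  by rewrite invr_ge0 ler0n/= invf_le1// ler1n.
(* The non-strict level [A] at s lies in each strict level at s' < s, and strict levels define the
   distribution function. *)
move=> s' s'0 s's; apply: (le_trans dA); apply: le_measure; rewrite ?inE//.
  rewrite (_ : [set r | _] = profile c f @^-1` `]s', +oo[%classic).
    apply: measurable_preimageT; first exact: measurable_profile.
    exact: (@measurable_itv R `]s', +oo[).
  by apply/seteqP; split => r /=; rewrite in_itv/= andbT.
by move=> r /= sr; exact: lt_le_trans sr.
Qed.

End geodesic_bound.

(** * Exceptional geodesics *)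

Section exceptional_geodesics.
Context {R : realType}.
Implicit Types (c : model_space) (n : nat).

(* Great circles in the equator are excluded, as f is arbitrary there. *)
Definition exceptional c n : set (geodesic_space (R := R) c n) :=
  [set xi | ~ (Xi1 c xi /\ ~ equatorial c xi)].

(** [row_cons] splits off the first coordinate while the condition is on the last; the induction
    descends to one coordinate, where the set is a point of R. *)
Lemma lebesgue_row_hyperplane n :
  lebesgue_row n.+1 [set x : 'rV[R]_n.+1 | x ord0 ord_max = 0] = 0%E.
Proof.
have mH m : measurable [set x : 'rV[R]_m.+1 | x ord0 ord_max = 0].
  rewrite (_ : [set x | _] = row_coor ord_max @^-1` [set (0 : R)])//.
  by apply: measurable_preimageT => //; exact: measurable_row_coor.
have stepE m (B : set 'rV[R]_m.+1) : lebesgue_row m.+1 B =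
  (@lebesgue_measure R \x lebesgue_row m)%E (@row_cons R m @^-1` B) by [].
elim: n => [|n ih]; rewrite stepE.
  rewrite (_ : _ @^-1` _ = [set (0 : R)] `*` setT).
    rewrite product_measure1E//; apply: etrans (mul0e _).
    by congr (_ * _)%E; exact: lebesgue_measure_set1.
  apply/seteqP; split => -[t u] /=; rewrite (_ : ord_max = ord0) ?row_cons0//=;
    first [exact: val_inj|by move=> []|by []].
rewrite (_ : _ @^-1` _ = setT `*` [set x : 'rV[R]_n.+1 | x ord0 ord_max = 0]).
  rewrite product_measure1E//; last exact: mH.
  by apply: etrans (mule0 _); congr (_ * _)%E; exact: ih.
have E : ord_max = lift ord0 (ord_max : 'I_n.+1) :> 'I_n.+2 by exact: val_inj.
by apply/seteqP; split => -[t u] /=; rewrite E row_cons_lift//= => -[].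
Qed.

Lemma normalized_enorm n (y : 'rV[R]_n) : 0 < enorm y ->
  enorm ((enorm y)^-1 *: y) = 1.
Proof.
move=> y0; have yi0 : 0 <= (enorm y)^-1 by rewrite invr_ge0 ltW.
by rewrite enormZ ger0_norm// mulVf// gt_eqF.
Qed.

(** For p.2 = 0 the span is one point, whereas a unit-speed geodesic separates the parameters 0 and
    1. All pairs are treated, not only [spanning_pairs], because a set of geodesics is measurable
    when its whole preimage is. *)
Lemma span_geodesic_Xi1_euclidean n (p : 'rV[R]_n * 'rV[R]_n) :
  Xi1 Euclidean (@span_geodesic R Euclidean n p) <-> p.2 <> 0.
Proof.
case: p => u v /=; split => [[[x w] [/= [_ w1 w0] E]] v0|/eqP v0].
  have e t : geodesic Euclidean (x, w) t = row_snoc u 1.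
    have : range (geodesic Euclidean (x, w)) (geodesic Euclidean (x, w) t) by exists t.
    by rewrite -E => -[t' _ <-]; rewrite v0 scaler0 addr0.
  have := etrans (e 1) (esym (e 0)); rewrite !geodesicE scale1r scale0r addr0.
  move/eqP; rewrite addrC -subr_eq0 addrK => /eqP w00; move: w1.
  by rewrite w00 -(scale0r 0) enormZ normr0 mul0r => /eqP; rewrite eq_sym oner_eq0.
have nv : 0 < enorm v by rewrite enorm_gt0.
exists (row_snoc u 1, row_snoc ((enorm v)^-1 *: v) 0); split => /=.
  split => /=; rewrite ?row_snoc_max//.
  apply/enorm_eq1; rewrite dot_row_snoc mulr0 addr0.
  by apply/enorm_eq1; exact: normalized_enorm.
have E t : row_snoc (u + t *: v) 1 = row_snoc u 1 + t *: row_snoc v 0.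
  by rewrite -row_snocZ mulr0 -row_snocD addr0.
have -> : row_snoc ((enorm v)^-1 *: v) 0 = (enorm v)^-1 *: row_snoc v 0.
  by rewrite -row_snocZ mulr0.
apply/seteqP; split=> _ [t _ <-].
  exists (t * enorm v) => //; rewrite geodesicE scalerA E.
  by rewrite mulfK// gt_eqF.
by exists (t / enorm v) => //; rewrite geodesicE scalerA E.
Qed.

Definition gram n (x y : 'rV[R]_n) : R := dot x x * dot y y - dot x y ^+ 2.

(** A change of generators multiplies [gram] by the square of its determinant, so a degenerate pair
    cannot span an orthonormal one. Conversely, normalizing an independent pair puts it in
    [spanning_pairs] with the same span. *)
Lemma span_geodesic_Xi1_spherical n (p : 'rV[R]_n.+1 * 'rV[R]_n.+1) :
  Xi1 Spherical (@span_geodesic R Spherical n p) <-> gram p.1 p.2 <> 0.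
Proof.
case: p => u v /=; split => [[[x w] [/= [/= /enorm_eq1 xx /enorm_eq1 ww xw] E]] g0|/eqP g0].
  have [_ [a [b xE]]] : @span_geodesic R Spherical n (u, v) x.
    by rewrite (E : @span_geodesic R Spherical n (u, v) = _); exists 0 => //;
      rewrite geodesicE cos0 sin0 scale1r scale0r addr0.
  have [_ [a' [b' wE]]] : @span_geodesic R Spherical n (u, v) w.
    rewrite (E : @span_geodesic R Spherical n (u, v) = _); exists (pi / 2) => //.
    by rewrite geodesicE cos_pihalf sin_pihalf scale1r scale0r add0r.
  have : gram x w = (a * b' - b * a') ^+ 2 * gram u v.
    rewrite /gram xE wE !(dotDl, dotDr, dotZl, dotZr) /= (dotC v u); ring.
  by rewrite g0 mulr0 /gram xx ww xw; lra.
have u0 : u != 0.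
  apply: contra_neq g0 => ->.
  by rewrite /gram -(scale0r 0) !dotZl !mul0r expr0n subrr.
have v0 : v != 0.
  apply: contra_neq g0 => ->.
  by rewrite /gram -(scale0r 0) !dotZr !dotZl !mul0r mulr0 expr0n subrr.
have nu : 0 < enorm u by rewrite enorm_gt0.
have nv : 0 < enorm v by rewrite enorm_gt0.
rewrite -span_geodesicE; exists ((enorm u)^-1 *: u, (enorm v)^-1 *: v).
  have n1 (y : 'rV[R]_n.+1) : 0 < enorm y -> enorm ((enorm y)^-1 *: y) <= 1.
    by move=> y0; rewrite normalized_enorm.
  split => /=; [exact: n1|exact: n1|].
  rewrite eq_sym -subr_eq0 !(dotZl, dotZr).
  rewrite (_ : _ - _ = ((enorm u)^-1 * (enorm v)^-1) ^+ 2 * gram u v); last by rewrite /gram; ring.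
  by rewrite mulf_neq0// expf_neq0// mulf_neq0// invr_eq0 gt_eqF.
apply/seteqP; split => y /= [my [a [b yE]]]; split => //.
  by exists (a / enorm u), (b / enorm v); rewrite yE !scalerA.
exists (a * enorm u), (b * enorm v).
by rewrite yE !scalerA !mulfK// gt_eqF.
Qed.

(** The normalized generators are themselves points of the circle, so they inherit height 0 from
    it. *)
Lemma span_geodesic_equatorial n (p : 'rV[R]_n.+1 * 'rV[R]_n.+1) : gram p.1 p.2 <> 0 ->
  equatorial Spherical (@span_geodesic R Spherical n p) <->
  p.1 ord0 ord_max = 0 /\ p.2 ord0 ord_max = 0.
Proof.
case: p => u v /= /eqP g0; split => [[_ H]|[u0 v0]]; last first.
  by split=> // x [_ [a [b ->]]]; rewrite !mxE u0 v0 !mulr0 addr0.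
have key (y : 'rV[R]_n.+1) : y != 0 -> (exists a b : R, (enorm y)^-1 *: y = a *: u + b *: v) ->
    y ord0 ord_max = 0.
  move=> y0 ab; have ny : 0 < enorm y by rewrite enorm_gt0.
  have := H ((enorm y)^-1 *: y); rewrite mxE => h.
  have /eqP : (enorm y)^-1 * y ord0 ord_max = 0.
    by apply: h; split => //=; exact: normalized_enorm.
  by rewrite mulf_eq0 invr_eq0 gt_eqF//= => /eqP.
split; apply: key.
- apply: contra_neq g0 => ->.
  by rewrite /gram -(scale0r 0) !dotZl !mul0r expr0n subrr.
- by exists (enorm u)^-1, 0; rewrite scale0r addr0.
- apply: contra_neq g0 => ->.
  by rewrite /gram -(scale0r 0) !dotZr !dotZl !mul0r mulr0 expr0n subrr.
- by exists 0, (enorm v)^-1; rewrite scale0r add0r.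
Qed.

Lemma exceptional_euclideanE n :
  @span_geodesic R Euclidean n @^-1` (@exceptional Euclidean n) = [set p | p.2 = 0].
Proof.
apply/seteqP; split => p; rewrite /exceptional /=.
  move=> h; apply: contrapT => p0; apply: h; split; last by case.
  exact/span_geodesic_Xi1_euclidean.
by move=> p0 [/span_geodesic_Xi1_euclidean].
Qed.

Lemma exceptional_sphericalE n :
  @span_geodesic R Spherical n @^-1` (@exceptional Spherical n) =
  [set p : 'rV[R]_n.+1 * 'rV[R]_n.+1 | gram p.1 p.2 = 0] `|`
  [set p : 'rV[R]_n.+1 * 'rV[R]_n.+1 | p.1 ord0 ord_max = 0 /\ p.2 ord0 ord_max = 0].
Proof.
apply/seteqP; split => p; rewrite /exceptional.
  move=> h; have [g0|g0] := pselect (gram p.1 p.2 = 0); [by left|right].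
  apply/(span_geodesic_equatorial g0); apply: contrapT => neq; apply: h; split => //.
  exact/span_geodesic_Xi1_spherical.
move=> H [/span_geodesic_Xi1_spherical g0 neq]; case: H => //= h.
by apply: neq; exact/span_geodesic_equatorial.
Qed.

Lemma measurable_exceptional c n : measurable (@exceptional c n).
Proof.
rewrite /measurable/= /geodesic_algebra /image_set_system/= setTI.
case: c.
  rewrite exceptional_euclideanE.
  rewrite (_ : [set p | _] = (fun p : 'rV[R]_n * 'rV[R]_n => dot p.2 p.2) @^-1` [set 0]).
    by apply: measurable_preimageT => //; exact: measurable_dot.
  apply/seteqP; split => p /= /eqP; first by rewrite -dot_eq0 => /eqP.
  by rewrite dot_eq0 => /eqP.
rewrite exceptional_sphericalE; apply: measurableU.
  rewrite (_ : [set p | _] = (fun p : 'rV[R]_n.+1 * 'rV[R]_n.+1 => gram p.1 p.2) @^-1` [set 0])//.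
  apply: measurable_preimageT => //; apply: measurable_funB.
    by apply: measurable_funM; exact: measurable_dot.
  by apply: measurable_funX; exact: measurable_dot.
apply: measurableI.
  rewrite (_ : (fun x => _) = (row_coor ord_max \o fst) @^-1` [set (0 : R)])//.
  apply: measurable_preimageT => //; apply: measurableT_comp => //.
  exact: measurable_row_coor.
rewrite (_ : (fun x => _) = (row_coor ord_max \o snd) @^-1` [set (0 : R)])//.
apply: measurable_preimageT => //; apply: measurableT_comp => //.
exact: measurable_row_coor.
Qed.

(** Degenerate pairs are removed by the restriction to [spanning_pairs]. On the sphere, pairs
    spanning an equatorial circle remain; they have p.1 in a hyperplane, which is null. *)
Lemma geodesic_measure_exceptional c n : geodesic_measure R c n (@exceptional c n) = 0%E.
Proof.
rewrite /geodesic_measure /pushforward /mrestr.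
case: c.
  rewrite exceptional_euclideanE (_ : _ `&` _ = set0) ?measure0//.
  by rewrite -subset0 => p /= [p0 [/eqP]].
rewrite exceptional_sphericalE.
have mL : measurable [set x : 'rV[R]_n.+1 | x ord0 ord_max = 0].
  rewrite (_ : [set x | _] = row_coor ord_max @^-1` [set (0 : R)])//.
  by apply: measurable_preimageT => //; exact: measurable_row_coor.
apply: (@subset_measure0 _ _ _ _ _ ([set x : 'rV[R]_n.+1 | x ord0 ord_max = 0] `*` setT)).
- apply: measurableI; last exact: (@measurable_spanning_pairs R Spherical n).
  have := @measurable_exceptional Spherical n.
  by rewrite /measurable/= /geodesic_algebra /image_set_system/= setTI exceptional_sphericalE.
- exact: measurableX.
- move=> p [[/=|[? _] _]]; last by split.
  by rewrite /gram => /eqP; rewrite subr_eq0 eq_sym => /eqP -> [_ _ /eqP].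
apply: etrans (@product_measure1E _ _ _ _ _ (@lebesgue_row R n.+1)
  (@lebesgue_row R n.+1) _ _ mL measurableT) _.
apply: etrans (mul0e _); congr (_ * _)%E; exact: lebesgue_row_hyperplane.
Qed.

End exceptional_geodesics.

(** * Complex values and the essential supremum *)

Section final_bound.
Context {R : realType}.
Implicit Types (c : model_space) (n : nat).

Lemma Re_le_abs (z : R[i]) : `|complex.Re z| <= abs_complex z.
Proof. by rewrite abs_complexE -sqrtr_sqr ler_wsqrtr// lerDl sqr_ge0. Qed.

Lemma Im_le_abs (z : R[i]) : `|complex.Im z| <= abs_complex z.
Proof. by rewrite abs_complexE -sqrtr_sqr ler_wsqrtr// lerDr sqr_ge0. Qed.

Lemma abs_le_ReIm (z : R[i]) : abs_complex z <= `|complex.Re z| + `|complex.Im z|.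
Proof.
rewrite abs_complexE -[leRHS]ger0_norm ?addr_ge0// -sqrtr_sqr ler_wsqrtr//.
rewrite sqrrD !real_normK ?num_real// -addrA lerD2l lerDr.
by rewrite mulrn_wge0// mulr_ge0.
Qed.

(** As rho > 0, the bound makes the integral of |f| finite, whence integrability. The factor 2 comes
    from bounding the real and imaginary parts separately. *)
Lemma good_geodesic_bound c n (f : 'rV[R]_n.+1 -> R[i]) (xi : set 'rV[R]_n.+1)
    (rho B : R) : measurable_on c f -> Xi1 c xi -> 0 < rho ->
  derive1 (s_ c) (dist_origin c xi) = rho ->
  (rho%:E * \int[@lebesgue_measure R]_(t in arc_domain c)
     (abs_complex (f (along c xi t)))%:E <= B%:E)%E ->
  integrable_along c xi f /\
  abs_complex ((derive1 (s_ c) (dist_origin c xi))%:C * R1_transform c f xi) <= 2 * B.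
Proof.
move=> mf xiX r0 -> HB; have [mRe mIm] := mf.
have mdom := measurable_arc_domain (R := R) c.
have mal := measurable_along xiX.
have alm : along c xi @` setT `<=` @model R c n by move=> _ [t _ <-]; exact: along_model.
set I := (\int[_]_(t in _) _)%E in HB.
have I0 : (0 <= I)%E by apply: integral_ge0 => t _; rewrite lee_fin abs_complex_ge0.
have Ifin : I \is a fin_num.
  rewrite ge0_fin_numE// ltNge leye_eq; apply/negP => /eqP Iy.
  by move: HB; rewrite Iy gt0_muley ?lte_fin// leye_eq.
have mabs : measurable_fun (arc_domain c) (fun t => (abs_complex (f (along c xi t)))%:E).
  apply: measurable_funTS; apply/measurable_EFinP.
  by apply: (measurable_abs_comp _ mf).
have key (g : R[i] -> R) : measurable_fun (@model R c n) (fun x => g (f x)) ->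
    (forall z, `|g z| <= abs_complex z) ->
    (@lebesgue_measure R).-integrable (arc_domain c) (fun t => (g (f (along c xi t)))%:E) /\
    `|\int[@lebesgue_measure R]_(t in arc_domain c) g (f (along c xi t))| <= fine I.
  move=> mg gabs.
  have mgt : measurable_fun (arc_domain c) (fun t => (g (f (along c xi t)))%:E).
    apply: measurable_funTS; apply/measurable_EFinP.
    exact: (measurable_comp (@measurable_model _ c n) alm mg mal).
  have le : (\int[@lebesgue_measure R]_(t in arc_domain c)
      `|(g (f (along c xi t)))%:E| <= I)%E.
    apply: ge0_le_integral => //.
    - exact: measurableT_comp.
    - by move=> t _; rewrite lee_fin.
  have int : (@lebesgue_measure R).-integrable (arc_domain c)
      (fun t => (g (f (along c xi t)))%:E).
    apply/integrableP; split => //; apply: (le_lt_trans le).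
    by rewrite -ge0_fin_numE.
  split => //; rewrite -lee_fin fineK//; apply: le_trans le.
  apply: (le_trans _ (le_abse_integral (@lebesgue_measure R) mdom mgt)).
  by rewrite /Rintegral -abse_EFin fineK// integrable_fin_num.
have [iRe bRe] := key _ mRe Re_le_abs.
have [iIm bIm] := key _ mIm Im_le_abs.
split; first by split.
have rI : rho * fine I <= B by rewrite -lee_fin EFinM fineK.
rewrite [abs_complex _]ComplexField.Normc.normcM -!/(abs_complex _).
have -> : abs_complex rho%:C = rho by rewrite abs_complexE/= expr0n addr0 sqrtr_sqr gtr0_norm.
apply: (@le_trans _ _ (rho * (fine I + fine I))); last by lra.
rewrite ler_pM2l//; apply: (le_trans (abs_le_ReIm _)); rewrite /R1_transform/=.
exact: lerD.
Qed.

Lemma lorentz_norm_ge0 c n (f : 'rV[R]_n.+1 -> R[i]) : (0 <= lorentz_norm c f)%E.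
Proof.
rewrite mule_ge0// ?lee_fin ?invr_ge0//; apply: integral_ge0 => t.
rewrite /= in_itv/= andbT => t0; rewrite mule_ge0// ?lee_fin ?invr_ge0 ?(ltW t0)//.
by rewrite mule_ge0// ?lee_fin ?powR_ge0//; exact: generalized_inverse_ge0.
Qed.

End final_bound.

Unset Implicit Arguments.

Theorem theorem3p7 (R : realType) (c : model_space) (n : nat) (hn : (2 <= n)%N) :
  exists2 K : R, 0 < K &
    forall f : 'rV[R]_n.+1 -> R[i],
      sphere_even c f -> radial c f -> lorentz_space c f ->
      {ae geodesic_measure R c n, forall xi, integrable_along c xi f} /\
      ('N[geodesic_measure R c n]_+oo
         [(fun xi => (ComplexField.Normc.normc
            ((derive1 (s_ c) (dist_origin c xi))%:C * R1_transform c f xi))%:E)]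
       <= K%:E * lorentz_norm c f)%E.
Proof.
case: n hn => [|[|n]]// _.
have [C C0 HC] := @radial_line_integral R c n.
exists (2 * C) => [|f evf radf [mf nf]]; first by rewrite mulr_gt0.
have nfin : lorentz_norm c f \is a fin_num by rewrite ge0_fin_numE// lorentz_norm_ge0.
have good xi : Xi1 c xi -> ~ equatorial c xi -> integrable_along c xi f /\
    ((abs_complex ((derive1 (s_ c) (dist_origin c xi))%:C * R1_transform c f xi))%:E
    <= (2 * C)%:E * lorentz_norm c f)%E.
  move=> xiX neq; have [rho [r0 dE]] := HC f evf radf mf xi xiX neq.
  rewrite -(fineK nfin) -!EFinM => /(good_geodesic_bound mf xiX r0 dE)[? ?]; split => //.
  by rewrite lee_fin -mulrA.
have ae_good (P : geodesic_space (R := R) c n.+2 -> Prop) :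
    (forall xi, Xi1 c xi -> ~ equatorial c xi -> P xi) ->
    {ae geodesic_measure R c n.+2, forall xi, P xi}.
  move=> HP; exists (@exceptional R c n.+2); split.
  - exact: measurable_exceptional.
  - exact: geodesic_measure_exceptional.
  - by move=> xi nP [xiX neq]; apply: nP; exact: HP.
split; first by apply: ae_good => xi xiX neq; have [] := good xi xiX neq.
(* The norm with exponent +oo is 0 by convention when the total mass is 0, and an essential supremum
   otherwise. *)
rewrite unlock; case: ifP => _; last first.
  by rewrite mule_ge0 ?lorentz_norm_ge0// lee_fin ltW// mulr_gt0.
apply/ess_supP; apply: ae_good => xi xiX neq; have [_] := good xi xiX neq.
apply: le_trans; rewrite [leLHS]gee0_abs; first exact: lexx.
rewrite lee_fin.
exact (abs_complex_ge0 ((derive1 (s_ c) (dist_origin c xi))%:C * R1_transform c f xi)).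
Qed.
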